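(* Let $\{S_{\omega}\}_{\omega \in \Omega}$ be a net of subnormal operators in a complex Hilbert space $\mathcal H$ and let $S$ be a densely defined operator in $\mathcal H$. Suppose that there is a subset $\mathcal X$ of $\mathcal H$ such that (i) $\mathcal X \subseteq \mathcal D^\infty(S) \cap \bigcap_{\omega \in \Omega}\mathcal D^\infty(S_{\omega})$, (ii) $\mathcal F := \operatorname{lin} \bigcup_{n=0}^\infty S^n(\mathcal X)$ is a core of $S$, (iii) $\langle S^m x, S^n y\rangle = \lim_{\omega \in \Omega} \langle S_{\omega}^m x, S_{\omega}^n y\rangle$ for all $x,y \in \mathcal X$ and all integers $m,n \geq 0$. Then $S$ is subnormal.
   Context: All operators are linear and possibly unbounded; an operator $A$ in $\mathcal H$ is defined on a linear subspace $\mathcal D(A)\subseteq\mathcal H$. $\mathcal D^\infty(A)=\bigcap_{n=0}^\infty \mathcal D(A^n)$. $\operatorname{lin}$ denotes linear span. A linear subspace $\mathcal E$ of $\mathcal D(A)$ is a core of $A$ if the graph of $A$ is contained in the closure of the graph of the restriction $A|_{\mathcal E}$. A closed densely defined operator $N$ is normal if $N^*N=NN^*$. A densely defined operator $S$ in $\mathcal H$ is subnormal if there exist a complex Hilbert space $\mathcal K$ with $\mathcal H\subseteq\mathcal K$ (isometric embedding) and a normal operator $N$ in $\mathcal K$ such that $\mathcal D(S)\subseteq\mathcal D(N)$ and $Sh=Nh$ for all $h\in\mathcal D(S)$. *)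

(* Defs.v *)
From mathcomp Require Import all_boot all_order all_algebra.
From mathcomp Require Import all_classical all_reals all_analysis.
From mathcomp Require Import complex.
Set Implicit Arguments.
Unset Strict Implicit.
Unset Printing Implicit Defensive.
Import Order.TTheory GRing.Theory Num.Theory.
Import numFieldNormedType.Exports.
Local Open Scope classical_set_scope.
Local Open Scope ring_scope.

(* The inner product is linear in its first argument and conjugate-linear in
   its second one. *)
Record hilbertSpace (R : realType) : Type := HilbertSpace {
  hilbert_sort :> completeNormedModType R[i];
  inner : {dot hilbert_sort for @Num.conj R[i]};
  inner_norm : forall x : hilbert_sort, inner x x = `|x| ^+ 2
}.

Section Operators.
Context {R : realType}.
Implicit Types H : hilbertSpace R.

(* The values of [app] outside [dom] are meaningless: every definition below
   only evaluates [app] on [dom], and equality of operators is [op_eq]. *)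
Record partial_map (U : Type) : Type := PartialMap {
  dom : set U;
  app :> U -> U
}.

Definition subspace H (E : set H) : Prop :=
  E 0 /\ forall (a : R[i]) (x y : H), E x -> E y -> E (a *: x + y).

Definition linear_operator H (A : partial_map H) : Prop :=
  subspace (dom A) /\
  forall (a : R[i]) (x y : H), dom A x -> dom A y ->
    A (a *: x + y) = a *: A x + A y.

Definition op_eq H (A B : partial_map H) : Prop :=
  dom A = dom B /\ forall x : H, dom A x -> A x = B x.

Definition op_id H : partial_map H := PartialMap setT id.

Definition op_comp H (A B : partial_map H) : partial_map H :=
  PartialMap [set x | dom B x /\ dom A (B x)] (A \o B).

Definition op_pow H (A : partial_map H) (n : nat) : partial_map H :=
  iter n (op_comp A) (op_id H).

Definition dom_infty H (A : partial_map H) : set H :=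
  \bigcap_n dom (op_pow A n).

Definition densely_defined H (A : partial_map H) : Prop :=
  closure (dom A) = setT.

Definition graph_on H (A : partial_map H) (E : set H) : set (H * H) :=
  [set (x, A x) | x in E].

Definition graph H (A : partial_map H) : set (H * H) := graph_on A (dom A).

Definition closed_operator H (A : partial_map H) : Prop := closed (graph A).

(* For densely defined [A] the set [adjoint_values A y] has at most one
   element. *)
Definition adjoint_values H (A : partial_map H) (y : H) : set H :=
  [set z | forall x : H, dom A x -> inner H (A x) y = inner H x z].

Definition adjoint H (A : partial_map H) : partial_map H :=
  PartialMap [set y | adjoint_values A y !=set0]
             (fun y => xget 0 (adjoint_values A y)).

Definition normal_operator H (N : partial_map H) : Prop :=
  [/\ linear_operator N, closed_operator N, densely_defined N &
      op_eq (op_comp (adjoint N) N) (op_comp N (adjoint N))].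

Definition subnormal H (S : partial_map H) : Prop :=
  [/\ linear_operator S, densely_defined S &
      exists (K : hilbertSpace R) (J : {linear H -> K}) (N : partial_map K),
        [/\ forall x y : H, inner K (J x) (J y) = inner H x y,
            normal_operator N &
            forall h : H, dom S h -> dom N (J h) /\ J (S h) = N (J h)]].

Definition lin H (X : set H) : set H :=
  [set v | exists (n : nat) (a : 'I_n -> R[i]) (x : 'I_n -> H),
     (forall i, X (x i)) /\ v = \sum_(i < n) a i *: x i].

Definition core H (A : partial_map H) (E : set H) : Prop :=
  [/\ subspace E, E `<=` dom A & graph A `<=` closure (graph_on A E)].

End Operators.

Definition directed_preorder (W : Type) (le : W -> W -> Prop) : Prop :=
  [/\ inhabited W, forall w, le w w,
      forall u v w, le u v -> le v w -> le u w &
      forall u v, exists w, le u w /\ le v w].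

Definition net_filter (W : Type) (le : W -> W -> Prop) : set_system W :=
  filter_from setT (fun w0 => [set w | le w0 w]).

(* Main.v *)
(** Let [N_w] be a normal extension of [S_w].  By von Neumann's theorem
    [B = (1 + N_w^* N_w)^-1], [C = N_w B] and [D = C^*] are everywhere defined
    contractions with [BC = CB] and [DC = CD = B - B^2], and these identities
    survive in the ultraproduct of the spaces of the [N_w] along an ultrafilter
    finer than the net.  On the orthogonal complement of the kernel of the limit
    [B], the operator [B^-1 C] is normal: its adjoint is [B^-1 D] and the domains
    of both [N^* N] and [N N^*] are the range of [B].  By the hypothesis on the
    limits, [S^m x |-> (S_w^m x)_w] extends to an isometry of [H] into the
    ultraproduct.  Writing [g] and [g'] for the families of [S^m x] and [S^(m+1) x],
    the relations [g = B g + D g'] and [C g = B g'] show that the image lies in this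
    complement and that [B^-1 C] maps [g] to [g']; the core hypothesis extends this
    from the span of the [S^m x] to the domain of [S]. *)
Require Import Defs.
From HB Require Import structures.
From mathcomp Require Import all_boot all_order all_algebra.
From mathcomp Require Import all_classical all_reals all_analysis.
From mathcomp Require Import complex ring.
Import Order.TTheory GRing.Theory Num.Theory.
Import numFieldNormedType.Exports.
Set Implicit Arguments.
Unset Strict Implicit.
Unset Printing Implicit Defensive.
Local Open Scope classical_set_scope.
Local Open Scope ring_scope.

(** * Powers of two as error bounds *)

Lemma pow2_small {R : realType} (e : R[i]) : 0 < e -> exists n, 2 ^- n < e.
Proof.
case: e => a b; rewrite ltcE /= => /andP[/eqP -> a0].
have [n _ /(_ n (leqnn n))] := near_infty_natSinv_expn_lt (PosNum a0).
rewrite /= div1r => na; exists n.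
have -> : 2 ^- n = (2 ^- n : R)%:C%C by rewrite fmorphV rmorphXn/= rmorph_nat.
by rewrite ltcR.
Qed.

Lemma pow2_shift {R : realType} (c e : R[i]) : 0 < c -> 0 < e ->
  exists n, c * 2 ^- n < e.
Proof.
move=> c0 e0; have [|n ?] := @pow2_small R (e / c); first exact: divr_gt0.
by exists n; rewrite mulrC -ltr_pdivlMr.
Qed.

Lemma pow2_half {R : realType} n : 2 ^- n.+1 + 2 ^- n.+1 = 2 ^- n :> R[i].
Proof.
by rewrite exprS invfM -mulrDl -div1r -mulrDl divff ?pnatr_eq0// mul1r.
Qed.

Lemma pow2_gt0 {R : realType} n : 0 < 2 ^- n :> R[i].
Proof. by rewrite invr_gt0 exprn_gt0. Qed.

Lemma pow2_leS {R : realType} n : 2 ^- n.+1 <= 2 ^- n :> R[i].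
Proof. by rewrite -(pow2_half n) lerDl ltW// pow2_gt0. Qed.

Lemma pow2_squeeze {R : realType} (c a : R[i]) : 0 <= c ->
  (forall n, `|a| <= c * 2 ^- n) -> a = 0.
Proof.
move=> c0 h; apply/eqP; rewrite -normr_le0; apply/contraT => a0.
have {a0} ap : 0 < `|a| by rewrite lt_def normr_ge0 andbT; apply: contra a0 => /eqP ->.
(* [c + 1] is positive even when [c = 0]; the chosen [n] would give [c + 1 < c]. *)
have [n] := @pow2_shift R (c + 1) `|a| (ltr_wpDl c0 ltr01) ap.
move=> /lt_le_trans/(_ (h n)); rewrite ltr_pM2r ?pow2_gt0//.
by rewrite -subr_lt0 [c + 1]addrC addrK ltr10.
Qed.

(** * Semi-inner products *)

(* [comb a u v] plays the role of [a *: u + v]: the dependent families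
   [forall w, K_ w] used below carry no declared module structure. *)
Section SemiInner.
Context {R : realType} {V : Type}.
Variables (P : set V) (comb : R[i] -> V -> V -> V) (s : V -> V -> R[i]).

Record semi_inner : Prop := SemiInner {
  semi_comb : forall a u v, P u -> P v -> P (comb a u v);
  semi_linl : forall a u v w, P u -> P v -> P w ->
    s (comb a u v) w = a * s u w + s v w;
  semi_conj : forall u v, P u -> P v -> s v u = (s u v)^*;
  semi_ge0 : forall u, P u -> 0 <= s u u }.

Definition semi_norm (u : V) : R[i] := sqrtC (s u u).

Definition semi_dist (u v : V) : R[i] := semi_norm (comb (-1) v u).

(* The constant 4 is slack: it absorbs the square root of 2 of a product of two
   spaces and the factor 2 lost in an ultraproduct. *)
Definition semi_complete (Q : set V) : Prop :=
  forall u : nat -> V, (forall n, Q (u n)) ->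
    (forall n, semi_dist (u n.+1) (u n) <= 2 ^- n) ->
    exists2 v, Q v & forall n, semi_dist v (u n) <= 4 * 2 ^- n.

Hypothesis hs : semi_inner.

Lemma semi_linr a u v w : P u -> P v -> P w ->
  s w (comb a u v) = a^* * s w u + s w v.
Proof.
move=> Pu Pv Pw; rewrite (semi_conj hs (semi_comb hs a Pu Pv) Pw).
by rewrite (semi_linl hs)// rmorphD rmorphM/= (semi_conj hs Pu Pw) (semi_conj hs Pv Pw).
Qed.

Lemma semi_sq a u v : P u -> P v ->
  s (comb a u v) (comb a u v) =
  `|a| ^+ 2 * s u u + a * s u v + (a * s u v)^* + s v v.
Proof.
move=> Pu Pv; have Pc := semi_comb hs a Pu Pv.
rewrite (semi_linl hs)// !semi_linr// normCK rmorphM/= (semi_conj hs Pu Pv); ring.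
Qed.

(** The form may be degenerate, so a null [v] is treated apart: if [s u v] were nonzero, the
    multiple of [v] chosen there, added to [u], would give a vector of square [- (s u u + 2) < 0].
    Otherwise one subtracts from [u] its component along [v]. *)
Lemma semi_cauchy_schwarz u v : P u -> P v ->
  `|s u v| ^+ 2 <= s u u * s v v.
Proof.
move=> Pu Pv; have v0 := semi_ge0 hs Pv; have u0 := semi_ge0 hs Pu.
have [sv0|svN0] := eqVneq (s v v) 0.
  have [->|buv] := eqVneq (s u v) 0; first by rewrite normr0 expr0n/= mulr_ge0.
  have := semi_ge0 hs (semi_comb hs (- ((s u u + 1) / s v u)) Pv Pu).
  rewrite semi_sq// sv0 mulr0 add0r mulNr divfK; last first.
    by rewrite (semi_conj hs Pu Pv) conjC_eq0.
  have -> : (- (s u u + 1))^* = - (s u u + 1).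
    by apply/CrealP; rewrite rpredN realD ?ger0_real.
  rewrite -[X in 0 <= X]opprK oppr_ge0 => h.
  have : s u u + 2 <= 0 by apply: le_trans h; rewrite le_eqVlt; apply/orP; left; apply/eqP; ring.
  move=> h2; have : (0 : R[i]) < 0.
    by apply: lt_le_trans h2; rewrite ltr_wpDl.
  by rewrite ltxx.
have vp : 0 < s v v by rewrite lt_def svN0.
have := semi_ge0 hs (semi_comb hs (- (s u v / s v v)) Pv Pu).
have cv : (s v v)^* = s v v by apply/CrealP/ger0_real.
rewrite semi_sq// (semi_conj hs Pu Pv) normrN normf_div.
rewrite (ger0_norm v0) rmorphM/= rmorphN/= rmorphM/= conjCK fmorphV/= cv => h.
have : 0 <= (s u u * s v v - `|s u v| ^+ 2) / s v v.
  apply: le_trans h _; rewrite le_eqVlt; apply/orP; left; apply/eqP.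
  rewrite expr_div_n !normCK; field.
  by rewrite svN0.
by rewrite pmulr_lge0 ?invr_gt0// subr_ge0.
Qed.

Lemma semi_norm_ge0 u : P u -> 0 <= semi_norm u.
Proof. by move=> Pu; rewrite sqrtC_ge0 semi_ge0. Qed.

Lemma semi_norm_bound u v : P u -> P v ->
  `|s u v| <= semi_norm u * semi_norm v.
Proof.
move=> Pu Pv; rewrite -(@ler_pXn2r _ 2) ?nnegrE ?mulr_ge0 ?semi_norm_ge0//.
by rewrite exprMn !sqrtCK semi_cauchy_schwarz.
Qed.

Lemma semi_norm_null u v : P u -> P v -> s u u = 0 -> s u v = 0.
Proof.
move=> Pu Pv u0; apply/eqP; rewrite -normr_eq0 -sqrf_eq0.
rewrite eq_le exprn_ge0// andbT.
by apply: le_trans (semi_cauchy_schwarz Pu Pv) _; rewrite u0 mul0r.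
Qed.

Lemma semi_norm_comb a u v : P u -> P v ->
  semi_norm (comb a u v) <= `|a| * semi_norm u + semi_norm v.
Proof.
move=> Pu Pv; have Pc := semi_comb hs a Pu Pv.
have n0 := semi_norm_ge0.
rewrite -(@ler_pXn2r _ 2) ?nnegrE ?addr_ge0 ?mulr_ge0 ?n0//.
rewrite sqrrD exprMn /semi_norm !sqrtCK semi_sq//.
rewrite lerD2r -addrA lerD2l.
set b := a * s u v.
have : `|b + b^*| <= `|a| * sqrtC (s u u) * sqrtC (s v v) *+ 2.
  apply: le_trans (ler_normD _ _) _; rewrite norm_conjC -mulr2n ler_pMn2r//.
  by rewrite normrM -mulrA ler_wpM2l// semi_norm_bound.
apply: le_trans; apply: real_ler_norm.
by apply/CrealP; rewrite rmorphD/= conjCK addrC.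
Qed.

End SemiInner.

Section SemiOrth.
Context {R : realType} {V : Type}.
Variables (P : set V) (comb : R[i] -> V -> V -> V) (s : V -> V -> R[i]).
Hypothesis hs : semi_inner P comb s.

Definition semi_orth (Q : set V) : set V :=
  [set u | P u /\ forall v, P v -> Q v -> s u v = 0].

Lemma semi_inner_orth Q : semi_inner (semi_orth Q) comb s.
Proof.
apply: SemiInner => [a u v [Pu uQ] [Pv vQ]|a u v w [Pu _] [Pv _] [Pw _]|u v [Pu _] [Pv _]|u [Pu _]].
- split=> [|w Pw Qw]; first exact: (semi_comb hs).
  by rewrite (semi_linl hs)// uQ// vQ// mulr0 addr0.
- exact: (semi_linl hs).
- exact: (semi_conj hs).
- exact: (semi_ge0 hs).
Qed.

(** Orthogonality passes to the limit: [s v w] equals [s (v - u n) w] for every [n], which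
    Cauchy-Schwarz makes arbitrarily small. *)
Lemma semi_complete_orth Q : semi_complete comb s P -> semi_complete comb s (semi_orth Q).
Proof.
move=> hc u Ou hu; have Pu n : P (u n) := (Ou n).1.
have [v Pv hv] := hc u Pu hu; exists v => //; split => // w Pw Qw.
apply: (@pow2_squeeze _ (4 * semi_norm s w)) => [|n].
  by rewrite mulr_ge0// (semi_norm_ge0 hs).
have -> : s v w = s (comb (-1) (u n) v) w.
  by rewrite (semi_linl hs)// (Ou n).2// mulr0 add0r.
apply: le_trans (semi_norm_bound hs (semi_comb hs _ (Pu n) Pv) Pw) _.
by rewrite mulrAC ler_wpM2r ?(semi_norm_ge0 hs)//; exact: hv.
Qed.

End SemiOrth.

(** * The Hilbert space of a complete semi-inner product *)

Section HilbertOfSemiInner.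
Context {R : realType} {V : Type}.
Variables (P : set V) (comb : R[i] -> V -> V -> V) (s : V -> V -> R[i]) (z : V).
Hypotheses (hs : semi_inner P comb s) (Pz : P z) (hc : semi_complete comb s P).

(* The quotient by the null vectors is realised as the set of functionals
   [s v _], so that equality of classes is equality of functions. *)
Definition riesz_fun (v u : V) : R[i] := if `[< P u >] then s v u else 0.

Definition riesz_pred : {pred V -> R[i]} :=
  mem [set f | exists2 v, P v & f = riesz_fun v].

Lemma riesz_predP f : reflect (exists2 v, P v & f = riesz_fun v) (f \in riesz_pred).
Proof. by apply: (iffP idP) => [/set_mem|h]; [|exact/mem_set]. Qed.

Lemma riesz_fun_comb a u v : P u -> P v ->
  riesz_fun (comb a u v) = a *: riesz_fun u + riesz_fun v.
Proof.
move=> Pu Pv; apply/funext => w; rewrite /riesz_fun fctE /= fctE.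
by case: asboolP => [Pw|_]; [rewrite (semi_linl hs)|rewrite scaler0 addr0].
Qed.

Lemma riesz_submod_closed : submod_closed riesz_pred.
Proof.
split=> [|a f g /riesz_predP[u Pu ->] /riesz_predP[v Pv ->]]; apply/riesz_predP.
  exists (comb (-1) z z); first exact: (semi_comb hs).
  by rewrite riesz_fun_comb// scaleN1r addNr.
by exists (comb a u v); [exact: (semi_comb hs)|rewrite riesz_fun_comb].
Qed.

(** The three proofs are parameters of the type so that the instances declared on it can depend on
    them. *)
Definition riesz_type (_ : semi_inner P comb s) (_ : P z)
  (_ : semi_complete comb s P) : Type := {f : V -> R[i] | f \in riesz_pred}.

Local Notation T := (riesz_type hs Pz hc).

HB.instance Definition _ := SubChoice.on T.
HB.instance Definition _ :=
  GRing.SubChoice_isSubLmodule.Build R[i] (V -> R[i]) riesz_pred T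
    (GRing.submod_closed_semi riesz_submod_closed).

Lemma riesz_repr_ex (f : T) : exists2 v, P v & val f = riesz_fun v.
Proof. exact/riesz_predP/(valP f). Qed.

Definition riesz_repr (f : T) : V := projT1 (cid2 (riesz_repr_ex f)).

Lemma riesz_reprP (f : T) : P (riesz_repr f).
Proof. by rewrite /riesz_repr; case: cid2. Qed.

Lemma riesz_reprK (f : T) : val f = riesz_fun (riesz_repr f).
Proof. by rewrite /riesz_repr; case: cid2. Qed.

Definition riesz_dot (f g : T) : R[i] := s (riesz_repr f) (riesz_repr g).

(** The product is independent of representatives: equality of the functionals settles the first
    argument, and conjugate symmetry carries it over to the second. *)
Lemma riesz_dotE (f g : T) u v : P u -> P v ->
  val f = riesz_fun u -> val g = riesz_fun v -> riesz_dot f g = s u v.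
Proof.
move=> Pu Pv fu gv; rewrite /riesz_dot.
set f' := riesz_repr f; set g' := riesz_repr g.
have Pf : P f' := riesz_reprP f; have Pg : P g' := riesz_reprP g.
have /(congr1 (fun h => h g')) : riesz_fun f' = riesz_fun u.
  by rewrite -riesz_reprK.
rewrite /riesz_fun asboolT// => ->.
have /(congr1 (fun h => h u)) : riesz_fun g' = riesz_fun v.
  by rewrite -riesz_reprK.
rewrite /riesz_fun asboolT// => e.
by rewrite (semi_conj hs Pg Pu) e -(semi_conj hs Pv Pu).
Qed.

Lemma riesz_dot_conj f g : riesz_dot g f = (riesz_dot f g)^*.
Proof. exact: (semi_conj hs (riesz_reprP _) (riesz_reprP _)). Qed.

Lemma riesz_dot_lin a f g h :
  riesz_dot (a *: f + g) h = a * riesz_dot f h + riesz_dot g h.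
Proof.
rewrite (@riesz_dotE _ h (comb a (riesz_repr f) (riesz_repr g)) (riesz_repr h)).
- by rewrite (semi_linl hs)//; exact: riesz_reprP.
- by apply: (semi_comb hs); exact: riesz_reprP.
- exact: riesz_reprP.
- rewrite riesz_fun_comb; [|exact: riesz_reprP..].
  by rewrite -!riesz_reprK.
- exact: riesz_reprK.
Qed.

Lemma riesz_dot_linr a f g h :
  riesz_dot h (a *: f + g) = a^* * riesz_dot h f + riesz_dot h g.
Proof.
by rewrite riesz_dot_conj riesz_dot_lin rmorphD rmorphM/= -!riesz_dot_conj.
Qed.

Lemma riesz_dot_ge0 f : 0 <= riesz_dot f f.
Proof. exact: (semi_ge0 hs (riesz_reprP _)). Qed.

Lemma riesz_dot_eq0 f : riesz_dot f f = 0 -> f = 0.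
Proof.
move=> f0; apply: val_inj; rewrite riesz_reprK; apply/funext => u /=.
rewrite /riesz_fun; case: asboolP => // Pu.
exact: (semi_norm_null hs (riesz_reprP _) Pu f0).
Qed.

Lemma riesz_dot_semi_inner :
  semi_inner setT (fun a (f g : T) => a *: f + g) riesz_dot.
Proof.
split=> //.
- by move=> *; exact: riesz_dot_lin.
- by move=> *; exact: riesz_dot_conj.
- by move=> *; exact: riesz_dot_ge0.
Qed.

Definition riesz_norm (f : T) : R[i] := semi_norm riesz_dot f.

Lemma riesz_normZ (l : R[i]) f : riesz_norm (l *: f) = `|l| * riesz_norm f.
Proof.
rewrite /riesz_norm /semi_norm.
have -> : riesz_dot (l *: f) (l *: f) = `|l| ^+ 2 * riesz_dot f f.
  have dot0 g : riesz_dot g 0 = 0.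
    by have := riesz_dot_linr (-1) 0 0 g; rewrite scaler0 addr0 rmorphN1 mulN1r addNr.
  have dot0l g : riesz_dot 0 g = 0 by rewrite riesz_dot_conj dot0 conjC0.
  rewrite -[l *: f]addr0 riesz_dot_lin riesz_dot_linr dot0 dot0l !addr0.
  by rewrite normCK mulrA.
by rewrite sqrtCM ?nnegrE ?exprn_ge0// ?riesz_dot_ge0// sqrCK.
Qed.

Lemma riesz_normD f g : riesz_norm (f + g) <= riesz_norm f + riesz_norm g.
Proof.
have := semi_norm_comb riesz_dot_semi_inner 1 (I : setT f) (I : setT g).
by rewrite scale1r normr1 mul1r.
Qed.

Lemma riesz_norm_eq0 f : riesz_norm f = 0 -> f = 0.
Proof. by move=> /eqP; rewrite sqrtC_eq0 => /eqP/riesz_dot_eq0. Qed.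

HB.instance Definition _ := @Lmodule_isNormed.Build R[i] T riesz_norm
  riesz_normD riesz_normZ riesz_norm_eq0.

Definition riesz_class (v : V) : T :=
  insubd (0 : T) (riesz_fun v).

Lemma riesz_classE v : P v -> val (riesz_class v) = riesz_fun v.
Proof. by move=> Pv; rewrite insubdK//; apply/riesz_predP; exists v. Qed.

Lemma riesz_class_surj (f : T) : exists2 v, P v & riesz_class v = f.
Proof.
have [v Pv fv] := riesz_repr_ex f; exists v => //.
by apply: val_inj; rewrite riesz_classE.
Qed.

Lemma riesz_class_comb a u v : P u -> P v ->
  riesz_class (comb a u v) = a *: riesz_class u + riesz_class v.
Proof.
move=> Pu Pv; apply: val_inj; rewrite riesz_classE; last exact: (semi_comb hs).
rewrite riesz_fun_comb//.
by rewrite -!riesz_classE.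
Qed.

Lemma riesz_class_dot u v : P u -> P v ->
  riesz_dot (riesz_class u) (riesz_class v) = s u v.
Proof. by move=> Pu Pv; apply: riesz_dotE => //; rewrite riesz_classE. Qed.

Lemma riesz_class_dist u v : P u -> P v ->
  `|riesz_class u - riesz_class v| = semi_dist comb s u v.
Proof.
move=> Pu Pv; have Pc := semi_comb hs (-1) Pv Pu.
rewrite addrC -scaleN1r -riesz_class_comb//.
by rewrite /Num.norm/= /riesz_norm /semi_norm riesz_class_dot.
Qed.

(** Balls of radius [2 ^- n.+1] belonging to [F] intersect pairwise, so representatives of their
    centres form a sequence to which [semi_complete] applies. *)
Lemma riesz_complete (F : set_system T) : ProperFilter F -> cauchy F -> cvg F.
Proof.
move=> PF /cauchyP Fc.
have ball2 n : exists x, F (ball (x : T) (2 ^- n.+1 : R[i])).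
  by apply: Fc; exact: pow2_gt0.
have [x xF] := choice ball2.
have /choice[u xu] n : exists v, P v /\ riesz_class v = x n.
  by have [v] := riesz_class_surj (x n); exists v.
have Pu n : P (u n) by have [] := xu n.
have ux n : riesz_class (u n) = x n by have [] := xu n.
have [n|v Pv hv] := hc Pu.
  rewrite -riesz_class_dist// !ux.
  have [y []] := filter_ex (filterI (xF n) (xF n.+1)).
  rewrite -!ball_normE/= => h1 h2.
  rewrite -(subrKA y); apply: le_trans (ler_normD _ _) _.
  rewrite [X in _ + X]distrC; apply: le_trans (lerD (ltW h2) (ltW h1)) _.
  by rewrite -(pow2_half n) lerD2r pow2_leS.
apply/cvg_ex; exists (riesz_class v); apply/cvgrPdist_lt => e e0.
(* Of the 5, the completeness bound takes 4 and the radius of the ball takes 1. *)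
have [n ne] := @pow2_shift R 5 e (ltr0n _ 5) e0.
near=> y; rewrite -(subrKA (x n)).
apply: le_lt_trans (ler_normD _ _) _; apply: le_lt_trans ne.
have -> : 5 * 2 ^- n = 4 * 2 ^- n + 2 ^- n :> R[i] by ring.
apply: lerD; first by rewrite -ux riesz_class_dist.
have : ball (x n) (2 ^- n.+1) y by near: y; exact: xF.
rewrite -ball_normE/= => /ltW h; apply: le_trans h _.
exact: pow2_leS.
Unshelve. all: by end_near.
Qed.

HB.instance Definition _ := Uniform_isComplete.Build T riesz_complete.

Lemma riesz_bilinear : bilinear_for ( *%R : R[i] -> R[i] -> R[i])
  (@Num.conj R[i] \; *%R) riesz_dot.
Proof.
split=> u a v w /=; first by rewrite riesz_dot_lin.
by rewrite riesz_dot_linr.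
Qed.

HB.instance Definition _ := @bilinear_isBilinear.Build R[i] T T R[i]
  _ _ riesz_dot riesz_bilinear.

HB.instance Definition _ := @isHermitianSesquilinear.Build R[i] T
  false (@Num.conj R[i]) riesz_dot
  (fun x y => etrans (riesz_dot_conj y x) (esym (mul1r _))).

Lemma riesz_dot_gt0 (u : T) : u != 0 -> 0 < riesz_dot u u.
Proof.
move=> u0; rewrite lt_def riesz_dot_ge0 andbT.
by apply: contra u0 => /eqP h; apply/eqP; exact: (riesz_dot_eq0 h).
Qed.

HB.instance Definition _ := @isDotProduct.Build R[i] T
  riesz_dot riesz_dot_gt0.

Lemma hilbert_of_semi_inner : exists (K : hilbertSpace R) (J : V -> K),
  [/\ forall a u v, P u -> P v -> J (comb a u v) = a *: J u + J v,
      forall u v, P u -> P v -> inner K (J u) (J v) = s u v &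
      forall k, exists2 u, P u & J u = k].
Proof.
have hn (x : T) : riesz_dot x x = `|x| ^+ 2.
  by have -> : `|x| = sqrtC (riesz_dot x x) by []; rewrite sqrtCK.
exists (@HilbertSpace R T riesz_dot hn), riesz_class.
split; [exact: riesz_class_comb|exact: riesz_class_dot|exact: riesz_class_surj].
Qed.

End HilbertOfSemiInner.

(** * Orthogonal projection *)

(** The [comb] of an actual module, through which the semi-inner product lemmas apply to a Hilbert
    space and to the product of two. *)
Definition lcomb {C : nzRingType} {V : lmodType C} (a : C) (u v : V) := a *: u + v.

Section Projection.
Context {R : realType} {V : lmodType R[i]}.
Variables (s : V -> V -> R[i]) (P : set V).
Hypotheses (hs : semi_inner setT lcomb s) (P0 : P 0)
  (Plin : forall a u v, P u -> P v -> P (a *: u + v))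
  (hc : semi_complete lcomb s P).

Let sD a u v w : s (a *: u + v) w = a * s u w + s v w.
Proof. exact: (semi_linl hs). Qed.
Let sC u v : s v u = (s u v)^*.
Proof. exact: (semi_conj hs). Qed.
Let s0 u : 0 <= s u u.
Proof. exact: (semi_ge0 hs). Qed.
Let sB u v w : s (u - v) w = s u w - s v w.
Proof. by rewrite addrC -scaleN1r sD mulN1r addrC. Qed.
Let sBr u v w : s w (u - v) = s w u - s w v.
Proof. by rewrite sC sB rmorphB/= -!sC. Qed.
Let sA u v w : s (u + v) w = s u w + s v w.
Proof. by rewrite -[u]scale1r sD mul1r scale1r. Qed.
Let sAr u v w : s w (u + v) = s w u + s w v.
Proof. by rewrite sC sA rmorphD/= -!sC. Qed.
Let sZ a u w : s (a *: u) w = a * s u w.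
Proof. by rewrite -[a *: u]addr0 sD -(subrr u) sB subrr addr0. Qed.

(** Points of [P] that almost minimise the distance to [u] form a fast Cauchy sequence by the
    parallelogram law, and their residuals are almost orthogonal to [P]. Completeness is required of
    [P] alone, so that [P] may be the graph of a closed operator. *)
Lemma semi_projection u : exists2 p, P p & forall q, P q -> s (u - p) q = 0.
Proof.
pose D : set R := [set complex.Re (s (u - p) (u - p)) | p in P].
have ReK x : s x x = (complex.Re (s x x))%:C%C by rewrite RRe_real// ger0_real.
have hD : has_inf D.
  split; first by exists (complex.Re (s (u - 0) (u - 0))); exists 0.
  by exists 0 => _ [p Pp <-]; rewrite -ler0c -ReK.
pose d : R[i] := (inf D)%:C%C.
have dle p : P p -> d <= s (u - p) (u - p).
  by move=> Pp; rewrite ReK lecR; apply: ge_inf; [exact: hD.2|exists p].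
(* With this tolerance the parallelogram law bounds consecutive steps by exactly [2 ^- n]. *)
have /choice[p hp] n : exists p, P p /\ s (u - p) (u - p) <= d + (2 ^- n.+1) ^+ 2.
  have e0 : (0 : R) < (2 ^- n.+1) ^+ 2 by rewrite exprn_gt0// invr_gt0 exprn_gt0.
  have [_ [p Pp <-] /ltW hpe] := inf_adherent e0 hD.
  exists p; split => //; rewrite ReK /d.
  have -> : (2 ^- n.+1) ^+ 2 = ((2 ^- n.+1) ^+ 2 : R)%:C%C.
    by rewrite rmorphXn fmorphV rmorphXn/= rmorph_nat.
  by rewrite -rmorphD lecR.
have Pp n := (hp n).1; have {hp} dp n := (hp n).2.
(* Moving [p n] along [q] can lower the squared distance by [|s x q| ^+ 2 / s q q], hence this is at
   most the tolerance. *)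
have orth n q : P q -> `|s (u - p n) q| <= 2 ^- n.+1 * semi_norm s q.
  move=> Pq; set x := u - p n.
  have [q0|qN0] := eqVneq (s q q) 0.
    rewrite sC (semi_norm_null hs I I q0) conjC0 normr0.
    by rewrite mulr_ge0 ?(semi_norm_ge0 hs I)// ltW// pow2_gt0.
  have qp : 0 < s q q by rewrite lt_def qN0 s0.
  rewrite -(@ler_pXn2r _ 2) ?nnegrE ?mulr_ge0 ?(semi_norm_ge0 hs I) ?(ltW (pow2_gt0 _))//.
  rewrite exprMn sqrtCK.
  have h := le_trans (dle (lcomb (s x q / s q q) q (p n)) (Plin _ Pq (Pp n))) (lexx _).
  have e : u - lcomb (s x q / s q q) q (p n) = lcomb (- (s x q / s q q)) q x.
    by rewrite /lcomb scaleNr opprD addrCA.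
  rewrite e (semi_sq hs _ I I) (sC x q) in h.
  have cq : (s q q)^* = s q q by apply/CrealP/ger0_real.
  rewrite normrN normf_div (ger0_norm (s0 q)) rmorphM/= rmorphN/= rmorphM/=
    conjCK fmorphV/= cq in h.
  have {}h : d <= s x x - `|s x q| ^+ 2 / s q q.
    apply: le_trans h _; rewrite le_eqVlt; apply/orP; left; apply/eqP.
    by rewrite expr_div_n normCK; field.
  rewrite -ler_pdivrMr//; have := le_trans (dp n) (lerD h (lexx _)).
  by rewrite addrAC -addrA lerDl subr_ge0.
have parallelogram n : semi_dist lcomb s (p n.+1) (p n) <= 2 ^- n.
  have p2 : 0 <= 2 ^- n :> R[i] by rewrite ltW// pow2_gt0.
  rewrite /semi_dist /semi_norm -(sqrCK p2) ler_sqrtC ?nnegrE ?exprn_ge0//.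
  have e : lcomb (-1) (p n) (p n.+1) = (u - p n) - (u - p n.+1).
    by rewrite /lcomb scaleN1r opprB [RHS]addrC subrKA addrC.
  rewrite e; set x := u - p n; set y := u - p n.+1.
  have m : d <= s (2^-1 *: (x + y)) (2^-1 *: (x + y)).
    have -> : 2^-1 *: (x + y) = u - (2^-1 *: p n + 2^-1 *: p n.+1).
      rewrite /x /y addrACA scalerDr -opprD scalerN scalerDr -mulr2n.
      by rewrite scalerMnl -mulr_natl divff ?pnatr_eq0// scale1r scalerDr.
    by apply: dle; apply: Plin => //; rewrite -[_ *: _]addr0; exact: Plin.
  have hh : s (x - y) (x - y) + 4 * s (2^-1 *: (x + y)) (2^-1 *: (x + y)) =
            2 * s x x + 2 * s y y.
    have c2 : (2^-1 : R[i])^* = 2^-1 by rewrite fmorphV/= conjC_nat.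
    by rewrite sZ (sC (2^-1 *: _)) sZ rmorphM/= c2 -sC !(sA, sB, sAr, sBr); field.
  have : s (x - y) (x - y) + 4 * d <=
      2 * (d + (2 ^- n.+1) ^+ 2) + 2 * (d + (2 ^- n) ^+ 2 / 4).
    have -> : (2 ^- n) ^+ 2 / 4 = (2 ^- n.+1) ^+ 2 :> R[i].
      by rewrite -(pow2_half n); field.
    apply: (@le_trans _ _ (2 * s x x + 2 * s y y)).
      by rewrite -hh lerD2l ler_wpM2l.
    apply: lerD; rewrite ler_wpM2l//; apply: le_trans (dp _) _ => //.
    rewrite lerD2l ler_pXn2r ?nnegrE ?(ltW (pow2_gt0 _))//; exact: pow2_leS.
  have -> : 2 * (d + 2 ^- n.+1 ^+ 2) + 2 * (d + 2 ^- n ^+ 2 / 4) =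
            (2 ^- n) ^+ 2 + 4 * d.
    by rewrite -(pow2_half n); field.
  by rewrite lerD2r.
have [q Pq hq] := hc Pp parallelogram.
(* The 5 is 1 for the residual at [p n] plus 4 for the distance from [q] to [p n]. *)
exists q => // r Pr; apply: (@pow2_squeeze _ (5 * semi_norm s r)) => [|n].
  by rewrite mulr_ge0// (semi_norm_ge0 hs).
have -> : u - q = (u - p n) - (q - p n) by rewrite opprB subrKA.
rewrite sB; apply: le_trans (ler_normB _ _) _.
have -> : 5 * semi_norm s r * 2 ^- n = 2 ^- n * semi_norm s r + 4 * 2 ^- n * semi_norm s r by ring.
have r0 : 0 <= semi_norm s r by rewrite (semi_norm_ge0 hs).
apply: lerD.
  by apply: le_trans (orth _ _ Pr) _; rewrite ler_wpM2r// pow2_leS.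
apply: le_trans (semi_norm_bound hs I I) _; rewrite ler_wpM2r//.
by have := hq n; rewrite /semi_dist /lcomb scaleN1r addrC.
Qed.

End Projection.

(** * Inner product calculus in a Hilbert space *)

Section HilbertFacts.
Context {R : realType} (K : hilbertSpace R).
Implicit Types (x y z : K) (P : set K).

Lemma innerC x y : inner K y x = (inner K x y)^*.
Proof. by rewrite (hermitian_subproof (s := inner K)) expr0 mul1r. Qed.

Lemma innerPl a x y z : inner K (a *: x + y) z = a * inner K x z + inner K y z.
Proof. exact: (linearPl (inner K)). Qed.

Lemma innerPr a x y z : inner K z (a *: x + y) = a^* * inner K z x + inner K z y.
Proof. by rewrite innerC innerPl rmorphD rmorphM/= -!innerC. Qed.

Lemma innerDl x y z : inner K (x + y) z = inner K x z + inner K y z.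
Proof. by rewrite -{1}[x]scale1r innerPl mul1r. Qed.

Lemma innerDr x y z : inner K z (x + y) = inner K z x + inner K z y.
Proof. by rewrite innerC innerDl rmorphD/= -!innerC. Qed.

Lemma innerBl x y z : inner K (x - y) z = inner K x z - inner K y z.
Proof. by rewrite addrC -scaleN1r innerPl mulN1r addrC. Qed.

Lemma innerBr x y z : inner K z (x - y) = inner K z x - inner K z y.
Proof. by rewrite innerC innerBl rmorphB/= -!innerC. Qed.

Lemma inner0l y : inner K 0 y = 0.
Proof. by rewrite -(subrr y) innerBl subrr. Qed.

Lemma inner_eq0 x : inner K x x = 0 -> x = 0.
Proof. by rewrite inner_norm => /eqP; rewrite sqrf_eq0 normr_eq0 => /eqP. Qed.

Lemma inner_ext x y : (forall z, inner K z x = inner K z y) -> x = y.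
Proof.
move=> h; apply/eqP; rewrite -subr_eq0; apply/eqP/inner_eq0.
by rewrite innerBr h subrr.
Qed.

Lemma inner_semi_inner : semi_inner setT lcomb (inner K).
Proof.
apply: SemiInner => // [a u v w _ _ _|u v _ _]; first exact: innerPl.
exact: innerC.
Qed.

Lemma semi_norm_inner x : semi_norm (inner K) x = `|x|.
Proof. by rewrite /semi_norm inner_norm sqrCK. Qed.

Lemma semi_dist_inner x y : semi_dist lcomb (inner K) x y = `|x - y|.
Proof. by rewrite /semi_dist semi_norm_inner /lcomb scaleN1r addrC. Qed.

Lemma inner_bound x y : `|inner K x y| <= `|x| * `|y|.
Proof. by rewrite -!semi_norm_inner; exact: (semi_norm_bound inner_semi_inner). Qed.

End HilbertFacts.

(** * Fast Cauchy sequences and closures *)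

Lemma fast_cauchy_cvg {R : realType} (V : completeNormedModType R[i]) (u : nat -> V) :
  (forall n, `|u n.+1 - u n| <= 2 ^- n) ->
  exists v, forall n, `|v - u n| <= 2 * 2 ^- n.
Proof.
move=> hu.
(* The subtracted term makes the induction on [k] close up. *)
have tele n k : `|u (n + k)%N - u n| <= 2 * 2 ^- n - 2 * 2 ^- (n + k).
  elim: k => [|k IH]; first by rewrite addn0 !subrr normr0.
  rewrite addnS -(subrKA (u (n + k)%N)); apply: le_trans (ler_normD _ _) _.
  apply: le_trans (lerD (hu _) IH) _; rewrite addrCA lerD2l.
  rewrite -{1}(pow2_half (n + k)) -(pow2_half (n + k)) le_eqVlt.
  by apply/orP; left; apply/eqP; ring.
have tail n m : (n <= m)%N -> `|u m - u n| <= 2 * 2 ^- n.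
  move=> nm; rewrite -(subnKC nm); apply: le_trans (tele _ _) _.
  by rewrite gerBl mulr_ge0// ltW// pow2_gt0.
have : cvg (u @ \oo).
  apply/cauchy_cvgP/cauchyP => e e0.
  have [n ne] := @pow2_shift R 2 e (ltr0n _ 2) e0.
  exists (u n); exists n => // m /= nm; rewrite -ball_normE/= distrC.
  by apply: le_lt_trans ne; exact: tail.
move=> /cvg_ex[v uv]; exists v => n.
have /cvgrPdist_lt hv := uv; apply/ler_addgt0Pr => e e0.
have [N _ /(_ (maxn N n))] := hv e e0.
rewrite /= leq_maxl => /(_ isT) h; rewrite -(subrKA (u (maxn N n))).
apply: le_trans (ler_normD _ _) _; rewrite addrC lerD// ?tail ?leq_maxr//.
exact: ltW.
Qed.

Section ClosurePow.
Context {R : realType}.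

Lemma closure_pow2P (V : normedModType R[i]) (A : set V) x :
  closure A x <-> forall n, exists2 y, A y & `|x - y| <= 2 ^- n.
Proof.
split=> [cA n|h B].
  have [|y [Ay]] := cA (ball x (2 ^- n)); first by apply: nbhsx_ballx; exact: pow2_gt0.
  by rewrite -ball_normE/= => /ltW; exists y.
rewrite -nbhs_ballE => -[e /= e0 eB].
have [n ne] := pow2_small e0.
have [y Ay xy] := h n; exists y; split => //; apply: eB.
by rewrite -ball_normE/=; exact: le_lt_trans ne.
Qed.

Lemma closure_prod_pow2P (V W : normedModType R[i]) (A : set (V * W)) x y :
  closure A (x, y) <->
  forall n, exists a b, [/\ A (a, b), `|x - a| <= 2 ^- n & `|y - b| <= 2 ^- n].
Proof.
split=> [cA n|h B].
  have [|[a b] [Aab [/= ha hb]]] := cA (ball x (2 ^- n) `*` ball y (2 ^- n)).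
    exists (ball x (2 ^- n), ball y (2 ^- n)) => //.
    by split; apply: nbhsx_ballx; exact: pow2_gt0.
  by exists a, b; move: ha hb; rewrite -!ball_normE/= => /ltW ? /ltW.
move=> nB; have [[B1 B2] /= []] : filter_prod (nbhs x) (nbhs y) B by [].
rewrite -!nbhs_ballE => -[e /= e0 eB] [f /= f0 fB] BB.
have [n ne] := pow2_small e0; have [m mf] := pow2_small f0.
have mono k l : 2 ^- (k + l) <= 2 ^- k :> R[i].
  by elim: l => [|l IH]; [rewrite addn0|rewrite addnS (le_trans (pow2_leS _))].
have [a [b [Aab xa yb]]] := h (n + m)%N; exists (a, b); split => //; apply: BB.
split=> /=; [apply: eB|apply: fB]; rewrite -ball_normE/=.
- by apply: le_lt_trans ne; exact: le_trans xa _.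
- by apply: le_lt_trans mf; apply: le_trans yb _; rewrite addnC.
Qed.

End ClosurePow.

(** * Density and orthogonality *)

Section Density.
Context {R : realType} (K : hilbertSpace R).

Lemma closure_subspace (P : set K) : Defs.subspace P -> Defs.subspace (closure P).
Proof.
move=> [P0 Plin]; split; first exact: subset_closure.
move=> a x y /closure_pow2P cx /closure_pow2P cy; apply/closure_pow2P => n.
have [m hm] := @pow2_shift R (`|a| + 1) (2 ^- n)
  (ltr_wpDl (normr_ge0 _) ltr01) (pow2_gt0 _).
have [x' Px' xx'] := cx m; have [y' Py' yy'] := cy m.
exists (a *: x' + y'); first exact: Plin.
rewrite opprD addrACA -scalerBr; apply: le_trans (ler_normD _ _) _.
rewrite normrZ; apply: le_trans (ltW hm); rewrite mulrDl mul1r.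
by rewrite lerD// ler_wpM2l.
Qed.

(** The residual of the projection of any [u] onto the complete subspace [closure P] is orthogonal
    to [P], hence zero. *)
Lemma dense_of_orth (P : set K) : Defs.subspace P ->
  (forall y, (forall x, P x -> inner K x y = 0) -> y = 0) -> closure P = setT.
Proof.
move=> sP h; have [cP0 cPlin] := closure_subspace sP.
have hc : semi_complete lcomb (inner K) (closure P).
  move=> u Pu hu; have [|v hv] := @fast_cauchy_cvg R K u.
    by move=> n; have := hu n; rewrite semi_dist_inner.
  exists v => [|n]; last first.
    rewrite semi_dist_inner; apply: le_trans (hv n) _.
    by rewrite ler_wpM2r ?(ltW (pow2_gt0 _))// ler_nat.
  have -> : closure P = closure (closure P) by apply/closure_id/closed_closure.
  apply/closure_pow2P => n; exists (u n.+1) => //.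
  by apply: le_trans (hv _) _; rewrite mulr_natl mulr2n pow2_half.
apply/seteqP; split=> // u _.
have [p Pp hp] := semi_projection (inner_semi_inner K) cP0 cPlin hc u.
suff /eqP : u - p = 0 by rewrite subr_eq0 => /eqP ->.
apply: h => x Px; rewrite innerC hp ?conjC0//; exact: subset_closure.
Qed.

Lemma orth_of_dense (P : set K) y : closure P = setT ->
  (forall x, P x -> inner K x y = 0) -> y = 0.
Proof.
move=> dP h; apply/inner_eq0/(@pow2_squeeze _ `|y|) => // n.
have /closure_pow2P/(_ n)[x Px yx] : closure P y by rewrite dP.
have -> : inner K y y = inner K (y - x) y by rewrite innerBl (h x Px) subr0.
by apply: le_trans (inner_bound _ _) _; rewrite mulrC ler_wpM2l.
Qed.

End Density.

(** * Bounded transforms of normal operators *)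

Section LinearFunctions.
Context {C : nzRingType} {V W : lmodType C} (F : V -> W).
Hypothesis hF : forall a x y, F (a *: x + y) = a *: F x + F y.

Lemma lin_add x y : F (x + y) = F x + F y.
Proof. by rewrite -[x]scale1r hF !scale1r. Qed.

Lemma lin_sub x y : F (x - y) = F x - F y.
Proof. by rewrite addrC -scaleN1r hF scaleN1r addrC. Qed.

End LinearFunctions.

(** * The normal operator of a transform triple *)

Section TransformTriple.
Context {R : realType} {K : hilbertSpace R}.

(* For a normal operator [N] the three maps are [B = (1 + N^* N)^-1], [C = N B]
   and [D = C^*]. *)
Record transform_triple (B C D : K -> K) : Prop := TransformTriple {
  triple_BB : forall x y, inner K (B x) y = inner K x (B y);
  triple_CD : forall x y, inner K (C x) y = inner K x (D y);
  triple_comm : forall x, B (C x) = C (B x);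
  triple_DC : forall x, D (C x) = B x - B (B x);
  triple_CDE : forall x, C (D x) = B x - B (B x) }.

(** Having an adjoint forces linearity, which is why [transform_triple] does not list it. *)
Lemma adjoint_linear (F G : K -> K) :
  (forall x y, inner K (F x) y = inner K x (G y)) ->
  forall a x y, F (a *: x + y) = a *: F x + F y.
Proof.
move=> h a x y; apply: inner_ext => z.
by rewrite innerC h innerPl innerPr rmorphD rmorphM/= -!h -!innerC.
Qed.

Lemma adjoint_sym (F G : K -> K) :
  (forall x y, inner K (F x) y = inner K x (G y)) ->
  forall x y, inner K (G x) y = inner K x (F y).
Proof. by move=> h x y; rewrite innerC -h -innerC. Qed.

Variables (B C D : K -> K).
Hypothesis hT : transform_triple B C D.

Let hBB := triple_BB hT.
Let hCD := triple_CD hT.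
Let hDC' := adjoint_sym hCD.

Lemma triple_commD x : B (D x) = D (B x).
Proof.
by apply: inner_ext => z; rewrite -hBB -hCD -(triple_comm hT) hBB hCD.
Qed.

(** Since [D C = B - B^2]. Nonnegativity of the left side gives [|B x| ^+ 2 <= inner K (B x) x],
    from which both contraction bounds follow. *)
Lemma triple_normC x : `|C x| ^+ 2 = inner K (B x) x - `|B x| ^+ 2.
Proof.
by rewrite -!inner_norm hCD (triple_DC hT) innerBr -!hBB.
Qed.

Lemma triple_contractB x : `|B x| <= `|x|.
Proof.
have [->|B0] := eqVneq (B x) 0; first by rewrite normr0.
have Bp : 0 < `|B x| by rewrite normr_gt0.
rewrite -(ler_pM2l Bp) -expr2; apply: le_trans (_ : inner K (B x) x <= _).
  by rewrite -subr_ge0 -triple_normC exprn_ge0.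
apply: le_trans (inner_bound _ _).
rewrite real_ler_norm// -[X in X \is _](subrK (`|B x| ^+ 2)) -triple_normC.
by rewrite realD// ger0_real// exprn_ge0.
Qed.

Lemma triple_contractC x : `|C x| <= `|x|.
Proof.
rewrite -(@ler_pXn2r _ 2) ?nnegrE// triple_normC.
apply: le_trans (_ : inner K (B x) x <= _); first by rewrite gerBl exprn_ge0.
apply: le_trans (_ : `|B x| * `|x| <= _); last first.
  by rewrite expr2 ler_wpM2r// triple_contractB.
apply: le_trans (inner_bound _ _).
rewrite real_ler_norm// -[X in X \is _](subrK (`|B x| ^+ 2)) -triple_normC.
by rewrite realD// ger0_real// exprn_ge0.
Qed.

(** This is [B^-1 C]. The chosen [z] is unique only under the injectivity of [B], assumed next. *)
Definition triple_operator : partial_map K :=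
  PartialMap [set x | exists z, C x = B z] (fun x => xget 0 [set z | C x = B z]).

Hypothesis hB0 : forall x, B x = 0 -> x = 0.

Let B_lin := adjoint_linear hBB.
Let C_lin := adjoint_linear hCD.

Lemma triple_inj x y : B x = B y -> x = y.
Proof.
by move=> h; apply/eqP; rewrite -subr_eq0; apply/eqP/hB0; rewrite (lin_sub B_lin) h subrr.
Qed.

Lemma triple_operatorE x z : C x = B z -> triple_operator x = z.
Proof.
move=> h; rewrite /=; case: xgetP => [y _ hy|/(_ z)//].
by apply: triple_inj; rewrite -h -hy.
Qed.

Lemma triple_operatorP x : dom triple_operator x -> C x = B (triple_operator x).
Proof. by move=> [z hz]; rewrite (triple_operatorE hz). Qed.

Lemma triple_graphE : graph triple_operator = [set p | C p.1 = B p.2].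
Proof.
apply/seteqP; split=> [_ [x dx <-]|[x z] /= h]; first exact: triple_operatorP.
by exists x; [exists z|rewrite (triple_operatorE h)].
Qed.

(* Formally [N^* N B = 1 - B] with [N = B^-1 C] and [N^* = B^-1 D]. *)
Lemma triple_decomp x z : C x = B z -> x = B x + D z.
Proof.
move=> h; apply: triple_inj; rewrite (lin_add B_lin) triple_commD -h.
by rewrite (triple_DC hT) addrC subrK.
Qed.

(** The counterpart for [N N^* B = 1 - B]. *)
Lemma triple_decompD y w : D y = B w -> y = B y + C w.
Proof.
move=> h; apply: triple_inj; rewrite (lin_add B_lin) (triple_comm hT) -h.
by rewrite (triple_CDE hT) addrC subrK.
Qed.

(** Forwards, test on the vectors [B u], which the operator sends to [C u]. Backwards, expand
    [y = B y + C w] and [x = B x + D z]; the terms match in pairs. *)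
Lemma triple_adjointE y w : adjoint_values triple_operator y w <-> D y = B w.
Proof.
split=> [h|h x dx].
  apply: inner_ext => u; rewrite -hCD -hBB.
  have e : C (B u) = B (C u) by rewrite (triple_comm hT).
  by rewrite -(triple_operatorE e) h//; exists (C u).
have e := triple_operatorP dx; set z := triple_operator x in e *.
rewrite [in LHS](triple_decompD h) [in RHS](triple_decomp e) innerDr innerDl.
by rewrite -hBB -e hCD h -hBB hDC'.
Qed.

Lemma triple_adjoint_operatorE y w : D y = B w -> adjoint triple_operator y = w.
Proof.
move=> h; rewrite /=; case: xgetP => [v _ /triple_adjointE hv|/(_ w)].
  by apply: triple_inj; rewrite -h -hv.
by move=> []; apply/triple_adjointE.
Qed.

(** The graph is the set where [C x = B z], closed because [B] and [C] are contractions. The domain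
    contains the range of [B], which is dense because [B] is symmetric and injective. Both products
    are the map [B u |-> u - B u]. *)
Lemma triple_normal : normal_operator triple_operator.
Proof.
have slin : linear_operator triple_operator.
  split=> [|a x y dx dy].
    split; first by exists 0; rewrite -(subrr (0 : K)) (lin_sub C_lin) (lin_sub B_lin) !subrr.
    by move=> a x y [z hz] [w hw]; exists (a *: z + w); rewrite C_lin B_lin hz hw.
  by apply: triple_operatorE; rewrite C_lin B_lin -!triple_operatorP.
split=> //.
- rewrite /closed_operator triple_graphE => -[x z] /= /closure_prod_pow2P h.
  apply/eqP; rewrite -subr_eq0; apply/eqP; apply/eqP; rewrite -normr_eq0; apply/eqP.
  apply: (@pow2_squeeze _ 2) => // n; rewrite normr_id.
  have [a [b [/= ab xa zb]]] := h n.
  have -> : C x - B z = C (x - a) - B (z - b) by rewrite (lin_sub C_lin) (lin_sub B_lin) -ab opprB subrKA.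
  apply: le_trans (ler_normB _ _) _; rewrite mulr_natl mulr2n lerD//.
    exact: le_trans (triple_contractC _) _.
  exact: le_trans (triple_contractB _) _.
- apply: dense_of_orth; first by case: slin.
  move=> y hy; apply: hB0; apply: inner_ext => u; rewrite -hBB hy.
    by rewrite -(subrr (0 : K)) innerBr subrr.
  by exists (C u); rewrite (triple_comm hT).
- have e1 u : dom (op_comp (adjoint triple_operator) triple_operator) (B u) /\
      adjoint triple_operator (triple_operator (B u)) = u - B u.
    have e : triple_operator (B u) = C u.
      by apply: triple_operatorE; rewrite (triple_comm hT).
    have e' : D (C u) = B (u - B u) by rewrite (triple_DC hT) (lin_sub B_lin).
    split; last by rewrite e; exact: triple_adjoint_operatorE.
    split; first by exists (C u); rewrite (triple_comm hT).
    by exists (u - B u); apply/triple_adjointE; rewrite e.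
  have e2 u : dom (op_comp triple_operator (adjoint triple_operator)) (B u) /\
      triple_operator (adjoint triple_operator (B u)) = u - B u.
    have e : adjoint triple_operator (B u) = D u.
      by apply: triple_adjoint_operatorE; rewrite triple_commD.
    have e' : C (D u) = B (u - B u) by rewrite (triple_CDE hT) (lin_sub B_lin).
    split; last by rewrite e; exact: triple_operatorE.
    split; first by exists (D u); apply/triple_adjointE; rewrite triple_commD.
    by exists (u - B u); rewrite e.
  (* If [v] is the value of the product at [x], the decomposition of [x] reads [x = B x + B v]. *)
  have f1 x : dom (op_comp (adjoint triple_operator) triple_operator) x ->
      exists u, x = B u.
    move=> [dx [v /triple_adjointE hv]]; exists (x + v).
    by rewrite (lin_add B_lin) -hv; apply: triple_decomp; exact: triple_operatorP.
  have f2 x : dom (op_comp triple_operator (adjoint triple_operator)) x ->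
      exists u, x = B u.
    move=> [[w /triple_adjointE hw] [v hv]]; exists (x + v).
    by rewrite (lin_add B_lin) -hv (triple_adjoint_operatorE hw); exact: triple_decompD.
  split=> [|x /f1[u ->]]; last by have [_ /= ->] := e1 u; have [_ /= ->] := e2 u.
  apply/seteqP; split=> x; first by move=> /f1[u ->]; exact: (e2 u).1.
  by move=> /f2[u ->]; exact: (e1 u).1.
Qed.

End TransformTriple.

(** * The bounded transform of a normal operator *)

Section BoundedTransform.
Context {R : realType} (K : hilbertSpace R) (N : partial_map K).
Hypothesis hN : normal_operator N.

Let Ndom0 : dom N 0.
Proof. by case: hN => -[[]]. Qed.
Let Ndom a x y : dom N x -> dom N y -> dom N (a *: x + y).
Proof. by case: hN => -[[_ h] _] _ _ _; exact: h. Qed.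
Let Nlin a x y : dom N x -> dom N y -> N (a *: x + y) = a *: N x + N y.
Proof. by case: hN => -[_ h] _ _ _; exact: h. Qed.
Let NdomB x y : dom N x -> dom N y -> dom N (x - y).
Proof. by move=> dx dy; rewrite addrC -scaleN1r; exact: Ndom. Qed.
Let NB x y : dom N x -> dom N y -> N (x - y) = N x - N y.
Proof. by move=> dx dy; rewrite addrC -scaleN1r Nlin// scaleN1r addrC. Qed.
Let Ndense : closure (dom N) = setT.
Proof. by case: hN. Qed.

Lemma adjoint_values_uniq y z w :
  adjoint_values N y z -> adjoint_values N y w -> z = w.
Proof.
move=> hz hw; apply/eqP; rewrite -subr_eq0; apply/eqP.
apply: (orth_of_dense Ndense) => x dx.
by rewrite innerBr -hz// -hw// subrr.
Qed.

Lemma adjointE y z : adjoint_values N y z -> adjoint N y = z.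
Proof.
move=> h; rewrite /=; case: xgetP => [w _ hw|/(_ z)//].
exact: adjoint_values_uniq hw h.
Qed.

(** Normality with its two compositions unfolded: [x] in the domain of [N^* N] is also in that of
    [N N^*], with the same value. The next lemma is the converse. *)
Lemma normal_adj1 x z : dom N x -> adjoint_values N (N x) z ->
  exists w, [/\ adjoint_values N x w, dom N w & N w = z].
Proof.
move=> dx hz; have [_ _ _ [e1 e2]] := hN.
have hx : dom (op_comp (adjoint N) N) x by split=> //; exists z.
have e : adjoint N (N x) = N (adjoint N x) := e2 x hx.
have [[w hw] dw] : dom (op_comp N (adjoint N)) x by rewrite -e1.
rewrite (adjointE hz) (adjointE hw) in e.
by exists w; split => //; rewrite -(adjointE hw).
Qed.

Lemma normal_adj2 x w : adjoint_values N x w -> dom N w ->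
  dom N x /\ adjoint_values N (N x) (N w).
Proof.
move=> hw dw; have [_ _ _ [e1 e2]] := hN.
have hx : dom (op_comp (adjoint N) N) x.
  by rewrite e1; split; [exists w|rewrite -/(adjoint N x) (adjointE hw)].
have e : adjoint N (N x) = N (adjoint N x) := e2 x hx.
have [dx [z hz]] := hx; split => //.
by rewrite (adjointE hz) (adjointE hw) in e; rewrite -e.
Qed.

(** Both coordinates converge, and the limit stays in the graph because [N] is closed. Each
    coordinate is within [2 * 2 ^- n], so the sum of squares is below the square of [4 * 2 ^- n]. *)
Lemma graph_semi_complete :
  semi_complete lcomb
    (fun p q : K * K => inner K p.1 q.1 + inner K p.2 q.2) (graph N).
Proof.
set s := fun p q => _; move=> u Pu hu.
have dist0 p q : semi_dist lcomb s p q = sqrtC (`|p.1 - q.1| ^+ 2 + `|p.2 - q.2| ^+ 2).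
  by rewrite /semi_dist /semi_norm /s /lcomb /= !inner_norm !scaleN1r ![- _ + _]addrC.
have dist_l p q (e : R[i]) : 0 <= e -> semi_dist lcomb s p q <= e ->
    `|p.1 - q.1| <= e /\ `|p.2 - q.2| <= e.
  move=> e0; rewrite dist0 => h.
  have {h} : `|p.1 - q.1| ^+ 2 + `|p.2 - q.2| ^+ 2 <= e ^+ 2.
    rewrite -[leLHS]sqrtCK; apply: lerXn2r => //; rewrite nnegrE//.
  by move=> h; split; rewrite -(@ler_pXn2r _ 2) ?nnegrE//; apply: le_trans h;
    rewrite ?lerDl ?lerDr exprn_ge0.
have p2 n : 0 <= 2 ^- n :> R[i] by rewrite ltW// pow2_gt0.
have [v1 h1] : exists v, forall n, `|v - (u n).1| <= 2 * 2 ^- n.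
  by apply: (@fast_cauchy_cvg R K) => n; have [] := dist_l _ _ _ (p2 n) (hu n).
have [v2 h2] : exists v, forall n, `|v - (u n).2| <= 2 * 2 ^- n.
  by apply: (@fast_cauchy_cvg R K) => n; have [] := dist_l _ _ _ (p2 n) (hu n).
exists (v1, v2) => [|n]; last first.
  rewrite dist0 /=.
  have -> : 4 * 2 ^- n = sqrtC ((2 * 2 ^- n + 2 * 2 ^- n) ^+ 2) :> R[i].
    rewrite sqrCK; first by ring.
    by rewrite addr_ge0// mulr_ge0.
  rewrite ler_sqrtC ?nnegrE ?exprn_ge0 ?addr_ge0 ?mulr_ge0 ?exprn_ge0//.
  rewrite sqrrD [leRHS]addrAC.
  apply: (@le_trans _ _ ((2 * 2 ^- n) ^+ 2 + (2 * 2 ^- n) ^+ 2)).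
    by apply: lerD; rewrite ler_pXn2r ?nnegrE ?mulr_ge0.
  by rewrite lerDl mulrn_wge0// mulr_ge0// mulr_ge0.
have [_ Nclosed _ _] := hN; apply: Nclosed; apply/closure_prod_pow2P => n.
have two : 2 * 2 ^- n.+1 = 2 ^- n :> R[i] by rewrite mulr_natl mulr2n pow2_half.
exists (u n.+1).1, (u n.+1).2; split; first by case: (u n.+1) (Pu n.+1).
  by rewrite -two.
by rewrite -two.
Qed.

(** Project [(u, 0)] onto the graph of [N]: orthogonality of the residual [(u - x, - N x)] to every
    [(y, N y)] says [N^* N x = u - x]. *)
Lemma adjoint_resolvent u : exists x, dom N x /\ adjoint_values N (N x) (u - x).
Proof.
pose s (p q : K * K) := inner K p.1 q.1 + inner K p.2 q.2.
have hs : semi_inner setT lcomb s.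
  apply: SemiInner => // [a p q r _ _ _|p q _ _|p _]; rewrite /s.
  - by rewrite /= !innerPl; ring.
  - by rewrite rmorphD/= -!innerC.
  - by rewrite addr_ge0.
have g0 : graph N 0.
  by exists 0 => //; rewrite -[in N 0](subrr (0 : K)) NB// subrr.
have glin (a : R[i]) (p q : K * K) : graph N p -> graph N q -> graph N (a *: p + q).
  move=> [x dx <-] [y dy <-]; exists (a *: x + y); first exact: Ndom.
  by rewrite Nlin.
have [_ [x dx <-] h] := semi_projection hs g0 glin graph_semi_complete (u, 0).
exists x; split => // y dy; have := h (y, N y).
rewrite /s /= => /(_ (ex_intro2 _ _ y dy erefl)).
rewrite (innerBl 0) inner0l sub0r => /subr0_eq e.
by rewrite innerC -e -innerC.
Qed.

(** The difference [d] of two solutions satisfies [|N d| ^+ 2 = - |d| ^+ 2]. *)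
Lemma adjoint_resolvent_uniq u x y :
  dom N x -> adjoint_values N (N x) (u - x) ->
  dom N y -> adjoint_values N (N y) (u - y) -> x = y.
Proof.
move=> dx hx dy hy; apply/eqP; rewrite -subr_eq0; apply/eqP/inner_eq0.
have d := NdomB dx dy; apply/eqP; rewrite inner_norm.
have e : inner K (N (x - y)) (N (x - y)) = - inner K (x - y) (x - y).
  rewrite [X in inner K _ X]NB// innerBr hx// hy// -innerBr.
  have -> : u - x - (u - y) = y - x by rewrite opprB addrC subrKA.
  by rewrite !innerBr opprB.
have := lexx (0 : R[i]).
rewrite -{1}(subrr (inner K (x - y) (x - y))) -e !inner_norm => h.
by rewrite eq_le exprn_ge0// andbT; apply: le_trans h; rewrite lerDl exprn_ge0.
Qed.

(* von Neumann: [1 + N^* N] is onto because the graph of [N] is closed. *)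
Lemma bounded_transform : exists B C D : K -> K,
  transform_triple B C D /\
  forall x, dom N x -> C x = B (N x) /\ x = B x + D (N x).
Proof.
have [B hB] := choice adjoint_resolvent.
have dB u : dom N (B u) := (hB u).1; have aB u := (hB u).2.
(* [D u] is [N^* B u]; normality gives [N (D u) = N^* N B u = u - B u]. *)
have /choice[D hD] u : exists w, [/\ adjoint_values N (B u) w, dom N w & N w = u - B u].
  exact: normal_adj1.
pose C u := N (B u).
have aD u : adjoint_values N (B u) (D u) by have [] := hD u.
have dD u : dom N (D u) by have [] := hD u.
have ND u : N (D u) = u - B u by have [] := hD u.
have eC u y : dom N y -> inner K (N y) (C u) = inner K y u - inner K y (B u).
  by move=> dy; rewrite aB// innerBr.
have hBB u v : inner K (B u) v = inner K u (B v).
  have e := eC u _ (dB v); have e' := eC v _ (dB u).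
  have := e'; rewrite -/(C u) innerC -/(C v) e rmorphB/= -!innerC => /eqP.
  by rewrite (inj_eq (addIr _)) => /eqP.
have hCD u v : inner K (C u) v = inner K u (D v).
  (* Here [v] is split as [N (D v) + B v], and each summand is moved across by an adjoint
     relation. *)
  rewrite -[v in LHS](subrK (B v)) innerDr -ND aD// innerC aB// innerBr.
  by rewrite rmorphB/= -!innerC subrK.
have hDC := adjoint_sym hCD.
(* [N B x] solves the resolvent equation for [N x], because [N^* N (N B x) = N (N^* N B x) = N x - N
   B x]. *)
have key x : dom N x -> C x = B (N x).
  move=> dx; have [d a] := normal_adj2 (aB x) (NdomB dx (dB x)).
  by rewrite NB// in a; apply: adjoint_resolvent_uniq (dB _) (aB _).
exists B, C, D; split; first split => //.
- by move=> x; rewrite -key.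
- move=> x; apply: inner_ext => v; rewrite -hCD eC// innerBr -!hBB.
  by rewrite !hBB.
- move=> x; apply: inner_ext => v; rewrite -hDC -aD// ND innerBl innerBr.
  by rewrite !hBB.
- move=> x dx; split; first exact: key.
  apply: inner_ext => v; rewrite innerDr -hCD [inner K (C v) _]innerC aB//.
  by rewrite innerBr rmorphB/= -!innerC hBB addrC subrK.
Qed.

End BoundedTransform.

(** * Ultraproducts *)

Section UltraLimit.
Context {R : realType} {Omega : Type} (U : set_system Omega).
Hypothesis UU : UltraFilter U.

(** Compactness of [[-M, M]] gives a cluster point, and an ultrafilter converges to each of its
    cluster points. *)
Lemma ultra_cvg_real (h : Omega -> R) (M : R) :
  (\forall w \near U, `|h w| <= M) -> exists l : R, h @ U --> l.
Proof.
move=> hM; have [] := @segment_compact R (- M) M (h @ U) _ _.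
  by apply: filterS hM => w; rewrite ler_norml /= in_itv.
move=> l [_ hl]; exists l => B Bl.
have [//|UnB] := in_ultra_setVsetC (h @^-1` B) UU.
by have [x [/= nBx Bx]] := hl (~` B) B UnB Bl.
Qed.

Definition ulimit (g : Omega -> R[i]) (l : R[i]) : Prop :=
  forall e, 0 < e -> \forall w \near U, `|l - g w| < e.

Lemma ulimit_ex (g : Omega -> R[i]) (M : R[i]) :
  (\forall w \near U, `|g w| <= M) -> exists l, ulimit g l.
Proof.
move=> gM.
have gRe : \forall w \near U, `|complex.Re (g w)| <= complex.Re M.
  apply: filterS gM => w h; have := le_trans (normc_ge_Re _) h.
  by rewrite lecE => /andP[].
have ni : `|'i%C : R[i]| = 1.
  by rewrite normc_def /= expr0n /= add0r expr1n sqrtr1.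
have gIm : \forall w \near U, `|complex.Im (g w)| <= complex.Re M.
  apply: filterS gM => w h.
  (* Multiplication by [i] turns the imaginary part into a real part, up to sign. *)
  have := normc_ge_Re (g w * 'i%C); rewrite ReiNIm normrN normrM ni mulr1.
  by move=> /le_trans/(_ h); rewrite lecE => /andP[].
have [a ha] := ultra_cvg_real gRe; have [b hb] := ultra_cvg_real gIm.
exists (Complex a b) => e e0.
have e2 : 0 < complex.Re e / 2.
  by rewrite divr_gt0//; move: e0; rewrite ltcE => /andP[].
have /cvgrPdist_lt/(_ _ e2) h1 := ha; have /cvgrPdist_lt/(_ _ e2) h2 := hb.
near=> w; have w1 : `|a - complex.Re (g w)| < complex.Re e / 2 by near: w.
have w2 : `|b - complex.Im (g w)| < complex.Re e / 2 by near: w.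
have -> : e = (complex.Re e)%:C%C by rewrite RRe_real// gtr0_real.
have -> : Complex a b - g w =
    (a - complex.Re (g w))%:C%C + 'i%C * (b - complex.Im (g w))%:C%C.
  by rewrite [LHS]complexE; case: (g w).
apply: le_lt_trans (ler_normD _ _) _; rewrite normrM ni.
have nr (x : R) : `|x%:C%C : R[i]| = `|x|%:C%C.
  by rewrite normc_def /= expr0n /= addr0 sqrtr_sqr.
rewrite mul1r !nr -rmorphD ltcR; apply: lt_le_trans (ltrD w1 w2) _.
by rewrite -mulrDl -mulr2n -[_ *+ 2]mulr_natr mulfK// pnatr_eq0.
Unshelve. all: by end_near.
Qed.

Lemma ulimit_uniq g l m : ulimit g l -> ulimit g m -> l = m.
Proof.
move=> gl gm; apply/eqP; rewrite -subr_eq0; apply/eqP.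
apply: (@pow2_squeeze _ 1) => // n; rewrite mul1r.
have p := @pow2_gt0 R n.+1.
have [w [h1 h2]] := filter_ex (filterI (gl _ p) (gm _ p)).
rewrite -(subrKA (g w)); apply: le_trans (ler_normD _ _) _.
by rewrite -(pow2_half n) [`|g w - m|]distrC lerD// ltW.
Qed.

Lemma ulimit_lin a g h l m : ulimit g l -> ulimit h m ->
  ulimit (fun w => a * g w + h w) (a * l + m).
Proof.
move=> gl hm e e0; have a0 : 0 < `|a| + 1 by rewrite ltr_wpDl.
have d0 : 0 < e / (`|a| + 1) by rewrite divr_gt0.
near=> w; have w1 : `|l - g w| < e / (`|a| + 1) by near: w; exact: gl.
have w2 : `|m - h w| < e / (`|a| + 1) by near: w; exact: hm.
rewrite opprD addrACA -mulrBr; apply: le_lt_trans (ler_normD _ _) _.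
rewrite -[ltRHS](divfK (lt0r_neq0 a0)) [ltRHS]mulrDr mulr1 normrM mulrC.
by rewrite ler_ltD// ler_wpM2r// ltW.
Unshelve. all: by end_near.
Qed.

Lemma ulimit_conj g l : ulimit g l -> ulimit (fun w => (g w)^*) l^*.
Proof. by move=> gl e /gl; apply: filterS => w; rewrite -rmorphB norm_conjC. Qed.

Lemma ulimit_eq g h l : ulimit g l -> (forall w, g w = h w) -> ulimit h l.
Proof. by move=> + gh; have -> : g = h by apply/funext. Qed.

(** In [R[i]], [0 <= l] includes that [l] is real; so one shows [|l| = l], both being close to
    [g w = |g w|]. *)
Lemma ulimit_ge0 g l :
  ulimit g l -> (\forall w \near U, 0 <= g w) -> 0 <= l.
Proof.
move=> gl g0; suff <- : `|l| = l by [].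
apply/eqP; rewrite -subr_eq0; apply/eqP.
apply: (@pow2_squeeze _ 1) => // n; rewrite mul1r -(pow2_half n).
have [w [h1 h2]] := filter_ex (filterI (gl _ (pow2_gt0 n.+1)) g0).
rewrite -(subrKA (g w)); apply: le_trans (ler_normD _ _) _.
rewrite [`|g w - l|]distrC lerD ?(ltW h1)//.
rewrite -{1}(ger0_norm h2); apply: le_trans (ltW h1).
exact: ler_dist_dist.
Qed.

Lemma ulimit_cst (c : R[i]) : ulimit (fun=> c) c.
Proof. by move=> e e0; apply: nearW => w; rewrite subrr normr0. Qed.

Lemma ulimit_le g l c :
  ulimit g l -> (\forall w \near U, g w <= c) -> l <= c.
Proof.
move=> gl gc; rewrite -subr_ge0 addrC -mulN1r.
apply: (ulimit_ge0 (ulimit_lin (-1) gl (ulimit_cst c))).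
by apply: filterS gc => w; rewrite mulN1r addrC subr_ge0.
Qed.

Lemma ulimit_lt_near g l e :
  ulimit g l -> (forall w, 0 <= g w) -> l < e -> \forall w \near U, g w < e.
Proof.
move=> gl g0 le; have l0 : 0 <= l by apply: (ulimit_ge0 gl); exact: nearW.
have := gl (e - l); rewrite subr_gt0 => /(_ le).
apply: filterS => w; rewrite distrC => h.
rewrite -(ltrD2r (- l)); apply: le_lt_trans h; apply: real_ler_norm.
by rewrite realB// ger0_real.
Qed.

End UltraLimit.

(** * The complete semi-inner product space of bounded families *)

Section Ultraproduct.
Context {R : realType} {Omega : Type} (U : set_system Omega).
Hypothesis UU : UltraFilter U.
Variable K_ : Omega -> hilbertSpace R.
Local Notation fam := (forall w, K_ w).

Definition fam_comb (a : R[i]) (f g : fam) : fam := fun w => a *: f w + g w.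

(** A bound on a member of [U] only, since convergence along the net yields no more. *)
Definition fam_bounded : set fam :=
  [set f | exists M : R[i], \forall w \near U, `|f w| <= M].

Definition fam_inner (f g : fam) : R[i] :=
  xget 0 [set l | ulimit U (fun w => inner (K_ w) (f w) (g w)) l].

Lemma fam_innerE f g l :
  ulimit U (fun w => inner (K_ w) (f w) (g w)) l -> fam_inner f g = l.
Proof.
move=> h; rewrite /fam_inner; case: xgetP => [m _ hm|/(_ l)//].
exact: (ulimit_uniq UU hm h).
Qed.

Lemma fam_inner_ulimit f g : fam_bounded f -> fam_bounded g ->
  ulimit U (fun w => inner (K_ w) (f w) (g w)) (fam_inner f g).
Proof.
move=> [M hM] [M' hM']; have [|l hl] := @ulimit_ex _ _ U UU
    (fun w => inner (K_ w) (f w) (g w)) (M * M').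
  apply: filterS2 hM hM' => w h h'.
  by apply: le_trans (inner_bound _ _) _; rewrite ler_pM.
by rewrite (fam_innerE hl).
Qed.

Lemma fam_semi_inner : semi_inner fam_bounded fam_comb fam_inner.
Proof.
apply: SemiInner.
- move=> a f g [M hM] [M' hM']; exists (`|a| * M + M').
  apply: filterS2 hM hM' => w h h'; apply: le_trans (ler_normD _ _) _.
  by rewrite normrZ lerD// ler_wpM2l.
- move=> a f g h Pf Pg Ph; apply: fam_innerE.
  apply: ulimit_eq (ulimit_lin UU a (fam_inner_ulimit Pf Ph) (fam_inner_ulimit Pg Ph)) _.
  by move=> w; rewrite /fam_comb innerPl.
- move=> f g Pf Pg; apply: fam_innerE.
  apply: ulimit_eq (ulimit_conj UU (fam_inner_ulimit Pf Pg)) _.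
  by move=> w; rewrite -innerC.
- move=> f Pf; apply: (ulimit_ge0 UU (fam_inner_ulimit Pf Pf)).
  by apply: nearW => w.
Qed.

Lemma fam_norm_le f (M : R[i]) : fam_bounded f -> 0 <= M ->
  (\forall w \near U, `|f w| <= M) -> semi_norm fam_inner f <= M.
Proof.
move=> Pf M0 hM; rewrite -(@ler_pXn2r _ 2) ?nnegrE//; last first.
  exact: (semi_norm_ge0 fam_semi_inner).
rewrite sqrtCK; apply: (ulimit_le UU (fam_inner_ulimit Pf Pf)).
by apply: filterS hM => w h; rewrite inner_norm ler_pXn2r ?nnegrE.
Qed.

Lemma fam_norm_lt f (M : R[i]) : fam_bounded f ->
  semi_norm fam_inner f < M -> \forall w \near U, `|f w| <= M.
Proof.
move=> Pf h; have n0 := semi_norm_ge0 fam_semi_inner Pf.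
have M0 := le_lt_trans n0 h.
have : fam_inner f f < M ^+ 2.
  by rewrite -[ltLHS]sqrtCK ltr_pXn2r ?nnegrE// ltW.
move=> /(ulimit_lt_near UU (fam_inner_ulimit Pf Pf)) H.
apply: filterS (H _) => [w|w]; last by [].
by rewrite inner_norm => /ltW; rewrite ler_pXn2r ?nnegrE// ltW.
Qed.

(* On each fibre the sequence is frozen as soon as it makes too large a step;
   for each [n] this changes the [n]-th term only outside a set of [U]. *)
Lemma fam_complete : semi_complete fam_comb fam_inner fam_bounded.
Proof.
move=> u Pu hu.
pose fix t n w {struct n} : K_ w := if n is m.+1 then
  (if `|u n w - t m w| <= 2 * 2 ^- m then u n w else t m w) else u 0%N w.
have tstep n w : `|t n.+1 w - t n w| <= 2 * 2 ^- n.
  by rewrite /=; case: ifP => // _; rewrite subrr normr0 mulr_ge0// ltW// pow2_gt0.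
have tnear n : \forall w \near U, t n w = u n w.
  elim: n => [|n IH]; first exact: nearW.
  (* The factor 2 makes the bound strict in the limit, as [fam_norm_lt] requires. *)
  have : \forall w \near U, `|fam_comb (-1) (u n) (u n.+1) w| <= 2 * 2 ^- n.
    apply: fam_norm_lt; first exact: (semi_comb fam_semi_inner).
    apply: le_lt_trans (hu n) _; rewrite mulr_natl mulr2n ltrDl.
    exact: pow2_gt0.
  apply: filterS2 IH => w e; rewrite /fam_comb scaleN1r addrC -e /= => ->.
  by [].
have tlim w : exists v, forall n, `|v - t n w| <= 4 * 2 ^- n.
  (* Halving the sequence brings its steps down to [2 ^- n]; doubling the limit afterwards gives the
     constant 4. *)
  have [|v hv] := @fast_cauchy_cvg R (K_ w) (fun n => 2^-1 *: t n w).
    move=> n; rewrite -scalerBr normrZ ger0_norm ?invr_ge0//.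
    by rewrite mulrC ler_pdivrMr// mulrC; exact: tstep.
  exists (2 *: v) => n.
  have -> : 2 *: v - t n w = 2 *: (v - 2^-1 *: t n w).
    by rewrite scalerBr scalerA divff ?pnatr_eq0// scale1r.
  rewrite normrZ ger0_norm//; have -> : 4 = 2 * 2 :> R[i] by rewrite -natrM.
  by rewrite -mulrA ler_wpM2l.
pose v : fam := fun w => projT1 (cid (tlim w)).
have vt w n : `|v w - t n w| <= 4 * 2 ^- n by rewrite /v; case: cid.
have Pv : fam_bounded v.
  have [M hM] := Pu 0%N; exists (4 * 2 ^- 0 + M).
  apply: filterS hM => w h; rewrite -(subrK (u 0%N w) (v w)).
  by apply: le_trans (ler_normD _ _) _; rewrite lerD//; exact: (vt w 0%N).
exists v => // n; apply: fam_norm_le.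
- exact: (semi_comb fam_semi_inner).
- by rewrite mulr_ge0// ltW// pow2_gt0.
- apply: filterS (tnear n) => w e; rewrite /fam_comb scaleN1r addrC -e.
  exact: vt.
Qed.

End Ultraproduct.

Lemma triple_swap {R : realType} {K : hilbertSpace R} (B C D : K -> K) :
  transform_triple B C D -> transform_triple B D C.
Proof.
move=> hT; split; first exact: (triple_BB hT).
- exact: adjoint_sym (triple_CD hT).
- exact: triple_commD hT.
- exact: triple_CDE hT.
- exact: triple_DC hT.
Qed.

(** * The limit of a family of transform triples *)

Section UltraTriple.
Context {R : realType} {Omega : Type} (U : set_system Omega).
Hypothesis UU : UltraFilter U.
Variable K_ : Omega -> hilbertSpace R.
Local Notation fam := (forall w, K_ w).
Local Notation P := (fam_bounded U (K_ := K_)).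
Local Notation s := (fam_inner U (K_ := K_)).
Local Notation comb := (@fam_comb R Omega K_).
Variables B C D : forall w, K_ w -> K_ w.
Hypothesis hT : forall w, transform_triple (@B w) (@C w) (@D w).

Definition fam_map (F : forall w, K_ w -> K_ w) (f : fam) : fam := fun w => F w (f w).

(* The orthogonal complement of the kernel of the limit of the [B w]. *)
Definition fam_core : set fam :=
  semi_orth P s [set g | s (fam_map B g) (fam_map B g) = 0].

Let hs := fam_semi_inner UU K_.

Let fam_map_bounded (F : forall w, K_ w -> K_ w) f :
  (forall w x, `|F w x| <= `|x|) -> P f -> P (fam_map F f).
Proof.
move=> hF [M hM]; exists M; apply: filterS hM => w; apply: le_trans.
exact: hF.
Qed.

Let PB f : P f -> P (fam_map B f).
Proof. by apply: fam_map_bounded => w; exact: triple_contractB (hT w). Qed.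

Let PC f : P f -> P (fam_map C f).
Proof. by apply: fam_map_bounded => w; exact: triple_contractC (hT w). Qed.

Let PD f : P f -> P (fam_map D f).
Proof. by apply: fam_map_bounded => w; exact: triple_contractC (triple_swap (hT w)). Qed.

Let fam_adj (F G : forall w, K_ w -> K_ w) f g :
  (forall w x y, inner (K_ w) (F w x) y = inner (K_ w) x (G w y)) ->
  s (fam_map F f) g = s f (fam_map G g).
Proof.
move=> h; rewrite /fam_inner.
have -> // : (fun w => inner (K_ w) (fam_map F f w) (g w)) =
  (fun w => inner (K_ w) (f w) (fam_map G g w)).
by apply/funext => w; exact: h.
Qed.

(** The adjoint [G] commutes with [B], hence preserves the kernel of the limit of [B], so [F]
    preserves its orthogonal complement. *)
Let core_map (F G : forall w, K_ w -> K_ w) f :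
  (forall w x y, inner (K_ w) (F w x) y = inner (K_ w) x (G w y)) ->
  (forall g, P g -> P (fam_map F g)) -> (forall g, P g -> P (fam_map G g)) ->
  (forall w x, B (G w x) = G w (B x)) ->
  fam_core f -> fam_core (fam_map F f).
Proof.
move=> adjFG PF PG BG [Pf hf]; split=> [|g Pg g0]; first exact: PF.
rewrite (fam_adj _ _ adjFG) hf//; first exact: PG.
rewrite /=; have -> : fam_map B (fam_map G g) = fam_map G (fam_map B g).
  by apply: functional_extensionality_dep => w; exact: BG.
have adjGF w := adjoint_sym (adjFG w).
rewrite (fam_adj _ _ adjGF) (semi_norm_null hs)//; first exact: PB.
by apply: PF; apply: PG; exact: PB.
Qed.

Let adjB w := triple_BB (hT w).
Let adjC w := triple_CD (hT w).
Let adjD w := adjoint_sym (@adjC w).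

Let coreB f : fam_core f -> fam_core (fam_map B f).
Proof. by apply: core_map (@adjB) PB PB _. Qed.

Let coreC f : fam_core f -> fam_core (fam_map C f).
Proof.
by apply: core_map (@adjC) PC PD _ => w x; exact: triple_commD (hT w) x.
Qed.

Let coreD f : fam_core f -> fam_core (fam_map D f).
Proof.
by apply: core_map (@adjD) PD PC _ => w x; exact: triple_comm (hT w) x.
Qed.

(** For [k] in the kernel, [s f k = s f (B k) + s g (C k)]. Both terms vanish: [B k] is null, and so
    is [C k], as [s (C k) (C k) = s k (B k) - s k (B (B k)) = 0]. *)
Lemma fam_core_of_step f g : P f -> P g ->
  (forall w, f w = B (f w) + D (g w)) -> fam_core f.
Proof.
move=> Pf Pg h; split=> // k Pk k0.
have -> : f = comb 1 (fam_map B f) (fam_map D g).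
  by apply: functional_extensionality_dep => w; rewrite /fam_comb scale1r; exact: h.
rewrite (semi_linl hs) ?mul1r; [|exact: PB|exact: PD|done].
rewrite (fam_adj _ _ (@adjB)) (fam_adj _ _ (@adjD)).
rewrite (semi_conj hs (PB Pk) Pf) (semi_norm_null hs (PB Pk) Pf k0) conjC0 add0r.
rewrite (semi_conj hs (PC Pk) Pg) (semi_norm_null hs (PC Pk) Pg) ?conjC0//.
rewrite (fam_adj _ _ (@adjC)).
have -> : fam_map D (fam_map C k) = comb (-1) (fam_map B (fam_map B k)) (fam_map B k).
  apply: functional_extensionality_dep => w.
  by rewrite /fam_comb scaleN1r addrC; exact: triple_DC (hT w) (k w).
have e1 : s k (fam_map B (fam_map B k)) = 0 by rewrite -(fam_adj _ _ (@adjB)).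
have e2 : s k (fam_map B k) = 0.
  by rewrite -(fam_adj _ _ (@adjB)) (semi_norm_null hs (PB Pk) Pk k0).
by rewrite (semi_linr hs) ?e1 ?e2 ?mulr0 ?addr0//; [do 2!apply: PB|exact: PB].
Qed.

Lemma ultraproduct_normal : exists (K : hilbertSpace R) (J : fam -> K) (N : partial_map K),
  [/\ normal_operator N,
      forall f g, fam_core f -> fam_core g -> inner K (J f) (J g) = s f g &
      forall f g, fam_core f -> fam_core g ->
        (forall w, C (f w) = B (g w)) -> dom N (J f) /\ N (J f) = J g].
Proof.
have ho := semi_inner_orth hs [set g | s (fam_map B g) (fam_map B g) = 0].
have hc : semi_complete comb s fam_core.
  exact: (semi_complete_orth hs (fam_complete UU (K_ := K_))).
have P0 : P (fun=> 0) by exists 0; apply: nearW => w; rewrite normr0.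
have core0 : fam_core (fun=> 0).
  apply: (fam_core_of_step P0 P0) => w.
  have lin0 (F : K_ w -> K_ w) :
      (forall a x y, F (a *: x + y) = a *: F x + F y) -> F 0 = 0.
    by move=> h; rewrite -(subrr (0 : K_ w)) (lin_sub h) !subrr.
  rewrite (lin0 _ (adjoint_linear (@adjB w))).
  by rewrite (lin0 _ (adjoint_linear (@adjD w))) addr0.
have [K [J [Jlin Jdot Jsurj]]] := hilbert_of_semi_inner ho core0 hc.
have /choice[r hr] k : exists f, fam_core f /\ J f = k.
  by have [f] := Jsurj k; exists f.
have rc k : fam_core (r k) := (hr k).1; have rK k : J (r k) = k := (hr k).2.
pose lift F k := J (fam_map F (r k)).
(* The lift does not depend on the representative: paired with any vector, [F f] becomes [f] paired
   with an image under [G]. *)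
have liftE (F G : forall w, K_ w -> K_ w) f :
    (forall w x y, inner (K_ w) (F w x) y = inner (K_ w) x (G w y)) ->
    (forall g, fam_core g -> fam_core (fam_map F g)) ->
    (forall g, fam_core g -> fam_core (fam_map G g)) ->
    fam_core f -> lift F (J f) = J (fam_map F f).
  move=> adjFG cF cG cf; apply: inner_ext => z; rewrite -(rK z) /lift.
  have adjGF w := adjoint_sym (adjFG w).
  rewrite !Jdot; [|exact: rc|exact: cF|exact: rc|exact/cF/rc].
  rewrite -!(fam_adj _ _ adjGF) -!Jdot ?rK//; by [exact: rc|exact/cG/rc].
have liftB f (cf : fam_core f) := liftE _ _ _ (@adjB) coreB coreB cf.
have liftC f (cf : fam_core f) := liftE _ _ _ (@adjC) coreC coreD cf.
have liftD f (cf : fam_core f) := liftE _ _ _ (@adjD) coreD coreC cf.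
have Jsub f g h : fam_core f -> fam_core g ->
    (forall w, h w = f w - g w) -> J h = J f - J g.
  move=> cf cg e; have -> : h = comb (-1) g f.
    by apply: functional_extensionality_dep => w; rewrite /fam_comb scaleN1r addrC.
  by rewrite Jlin// scaleN1r addrC.
have triple : transform_triple (lift B) (lift C) (lift D).
  split=> x; rewrite -(rK x); have cx := rc x.
  - move=> y; rewrite -(rK y); have cy := rc y.
    by rewrite !liftB// !Jdot//; [exact: fam_adj|exact: coreB|exact: coreB].
  - move=> y; rewrite -(rK y); have cy := rc y.
    by rewrite liftC// liftD// !Jdot//; [exact: fam_adj|exact: coreD|exact: coreC].
  - rewrite liftC// liftB; last exact: coreC.
    rewrite liftB// liftC; last exact: coreB.
    congr J; apply: functional_extensionality_dep => w; exact: triple_comm (hT w) _.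
  - rewrite liftC// liftD; last exact: coreC.
    rewrite liftB// liftB; last exact: coreB.
    apply: Jsub => [||w]; [exact: coreB|by do 2!apply: coreB|].
    exact: triple_DC (hT w) _.
  - rewrite liftD// liftC; last exact: coreD.
    rewrite liftB// liftB; last exact: coreB.
    apply: Jsub => [||w]; [exact: coreB|by do 2!apply: coreB|].
    exact: triple_CDE (hT w) _.
(* The representative of such an [x] lies both in the kernel and in its orthogonal complement. *)
have inj x : lift B x = 0 -> x = 0.
  move=> h; apply: inner_eq0; have [Pr hrx] := rc x.
  rewrite -(rK x) Jdot// hrx//= -Jdot; [|exact/coreB/rc..].
  by rewrite -/(lift B x) h inner0l.
exists K, J, (triple_operator (lift B) (lift C)); split.
- exact: triple_normal triple inj.
- exact: Jdot.
- move=> f g cf cg h.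
  have e : lift C (J f) = lift B (J g).
    rewrite liftC// liftB//; congr J.
    apply: functional_extensionality_dep => w; exact: h.
  by split; [exists (J g)|exact: triple_operatorE triple inj _ _ e].
Qed.

End UltraTriple.

(** * Limits of subnormal operators *)

Section IsometricExtension.
Context {R : realType} {H K : hilbertSpace R} (G : set (H * K)).
Hypotheses
  (Glin : forall a p q, G p -> G q -> G (a *: p + q))
  (Giso : forall p q, G p -> G q -> inner H p.1 q.1 = inner K p.2 q.2)
  (Gdense : closure [set h | exists k, G (h, k)] = setT).

Lemma closure_isometric p q : closure G p -> closure G q ->
  inner H p.1 q.1 = inner K p.2 q.2.
Proof.
case: p => h k; case: q => h' k' /closure_prod_pow2P c /closure_prod_pow2P c' /=.
apply/eqP; rewrite -subr_eq0; apply/eqP.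
(* The [+ 1] comes from [|a| <= |x| + 2 ^- n <= |x| + 1]. *)
have bound (L : hilbertSpace R) (x x' a a' : L) n : `|x - a| <= 2 ^- n ->
    `|x' - a'| <= 2 ^- n ->
    `|inner L x x' - inner L a a'| <= (`|x'| + (`|x| + 1)) * 2 ^- n.
  move=> xa xa'.
  have -> : inner L x x' - inner L a a' = inner L (x - a) x' + inner L a (x' - a').
    by rewrite innerBl innerBr addrA subrK.
  have p2 := ltW (@pow2_gt0 R n).
  apply: le_trans (ler_normD _ _) _; rewrite mulrDl; apply: lerD.
    by apply: le_trans (inner_bound _ _) _; rewrite mulrC ler_wpM2l.
  apply: le_trans (inner_bound _ _) _; apply: ler_pM => //.
  rewrite -[a](subKr x); apply: le_trans (ler_normB _ _) _; rewrite lerD2l.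
  by apply: le_trans xa _; rewrite invf_le1 ?exprn_gt0// exprn_ege1// ler1n.
pose M := (`|h'| + (`|h| + 1)) + (`|k'| + (`|k| + 1)).
have M0 : 0 <= M by rewrite !addr_ge0.
apply: (pow2_squeeze M0) => n.
have [a [b [Gab ha kb]]] := c n; have [a' [b' [Gab' ha' kb']]] := c' n.
have -> : inner H h h' - inner K k k' =
  (inner H h h' - inner H a a') - (inner K k k' - inner K b b').
  by rewrite (Giso Gab Gab') /= opprB subrKA.
by apply: le_trans (ler_normB _ _) _; rewrite mulrDl lerD// bound.
Qed.

(** Take points of [G] whose first coordinates tend fast to [h]; by isometry the second coordinates
    are fast Cauchy as well. *)
Lemma closure_total h : exists k, closure G (h, k).
Proof.
have /choice[p hp] n : exists p : H * K, G p /\ `|h - p.1| <= 2 ^- n.+1.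
  have /closure_pow2P/(_ n.+1)[a [b Gab] ha] : closure [set h | exists k, G (h, k)] h.
    by rewrite Gdense.
  by exists (a, b).
have Gp n : G (p n) := (hp n).1; have hpn n := (hp n).2.
have Gnorm q : G q -> `|q.2| = `|q.1|.
  by move=> Gq; rewrite -!semi_norm_inner /semi_norm Giso.
have [|k hk] := @fast_cauchy_cvg R K (fun n => (p n).2).
  move=> n; have := Glin (-1) (Gp n) (Gp n.+1) => /Gnorm.
  rewrite /= !scaleN1r ![- _ + _]addrC => ->.
  rewrite -(subrKA h); apply: le_trans (ler_normD _ _) _.
  rewrite [X in X + _]distrC -(pow2_half n) lerD//.
  by apply: le_trans (hpn _) _; exact: pow2_leS.
exists k; apply/closure_prod_pow2P => n; exists (p n.+1).1, (p n.+1).2; split.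
- by case: (p n.+1) (Gp n.+1).
- by apply: le_trans (hpn _) _; apply: le_trans (pow2_leS _) (pow2_leS _).
- by apply: le_trans (hk _) _; rewrite mulr_natl mulr2n pow2_half.
Qed.

Lemma isometric_extension : exists T : {linear H -> K},
  (forall x y, inner K (T x) (T y) = inner H x y) /\
  (forall h k, G (h, k) -> T h = k).
Proof.
have [T hT] := choice closure_total.
have iso x y : inner K (T x) (T y) = inner H x y.
  by rewrite -(closure_isometric (hT x) (hT y)).
(* The defect of linearity is a combination of values of [T] and is orthogonal to all values of
   [T]. *)
have Tlin : linear T.
  move=> a x y; apply/eqP; rewrite -subr_eq0; apply/eqP/inner_eq0.
  set v := T _ - _.
  have v0 z : inner K v (T z) = 0.
    by rewrite innerBl innerPl !iso innerPl subrr.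
  by rewrite {2}/v innerBr innerPr !v0 mulr0 addr0 subrr.
pose Tl : {linear H -> K} := HB.pack T (GRing.isLinear.Build _ _ _ _ T Tlin).
exists Tl; split=> [|h k Ghk]; first exact: iso.
have cG := @subset_closure _ G _ Ghk.
apply/eqP; rewrite -subr_eq0; apply/eqP/inner_eq0.
rewrite innerBl !innerBr.
rewrite -(closure_isometric (hT h) (hT h)) -(closure_isometric (hT h) cG).
by rewrite -(closure_isometric cG (hT h)) -(closure_isometric cG cG) !subrr.
Qed.

End IsometricExtension.

(** * Subnormality of the limit operator *)

Lemma net_filter_proper (W : Type) (le : W -> W -> Prop) :
  directed_preorder le -> ProperFilter (net_filter le).
Proof.
move=> [[w0] le_refl le_trans le_dir]; apply: filter_from_proper.
  apply: filter_from_filter; first by exists w0.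
  move=> u v _ _; have [w [uw vw]] := le_dir u v; exists w => // x wx.
  by split; [exact: le_trans uw wx|exact: le_trans vw wx].
by move=> w _; exists w; exact: le_refl.
Qed.

Theorem theorem3p1p1 (R : realType) (H : hilbertSpace R)
    (Omega : Type) (le : Omega -> Omega -> Prop)
    (Snet : Omega -> partial_map H) (S : partial_map H) (X : set H)
    (hOmega : directed_preorder le)
    (hSnet : forall w : Omega, subnormal (Snet w))
    (hSlin : linear_operator S)
    (hSdense : densely_defined S)
    (hX : X `<=` dom_infty S `&` \bigcap_w dom_infty (Snet w))
    (hcore : core S (lin (\bigcup_n (op_pow S n @` X))))
    (hlim : forall (x y : H) (m n : nat), X x -> X y ->
       (fun w : Omega => inner H (op_pow (Snet w) m x) (op_pow (Snet w) n y))
         @ net_filter le --> inner H (op_pow S m x) (op_pow S n y)) :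
  subnormal S.
Proof.
have PF := net_filter_proper hOmega.
have [U [UU FU]] := ultraFilterLemma PF.
have UP : ProperFilter U := @ultra_proper _ _ UU.
(* The extensions are extracted as data, because the types of [J] and [N] depend on the chosen
   space. *)
have ext w : {K : hilbertSpace R & {J : {linear H -> K} & {N : partial_map K |
    [/\ forall x y : H, inner K (J x) (J y) = inner H x y, normal_operator N &
        forall h : H, dom (Snet w) h -> dom N (J h) /\ J (Snet w h) = N (J h)]}}}.
  have [_ _ h] := hSnet w.
  by have [K {}h] := cid h; exists K; have [J {}h] := cid h; exists J; exact: cid h.
pose K_ w := projT1 (ext w).
pose J_ w : {linear H -> K_ w} := projT1 (projT2 (ext w)).
pose N_ w : partial_map (K_ w) := sval (projT2 (projT2 (ext w))).
have hext w : [/\ forall x y : H, inner (K_ w) (J_ w x) (J_ w y) = inner H x y,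
    normal_operator (N_ w) &
    forall h : H, dom (Snet w) h ->
      dom (N_ w) (J_ w h) /\ J_ w (Snet w h) = N_ w (J_ w h)].
  exact: svalP (projT2 (projT2 (ext w))).
clearbody N_ J_ K_; clear ext.
have bt w : {B : K_ w -> K_ w & {C : K_ w -> K_ w & {D : K_ w -> K_ w |
    transform_triple B C D /\
    forall x, dom (N_ w) x -> C x = B (N_ w x) /\ x = B x + D (N_ w x)}}}.
  have [_ Nnormal _] := hext w; have h := bounded_transform Nnormal.
  by have [B {}h] := cid h; exists B; have [C {}h] := cid h; exists C; exact: cid h.
pose B_ w := projT1 (bt w).
pose C_ w := projT1 (projT2 (bt w)).
pose D_ w := sval (projT2 (projT2 (bt w))).
have hbt w : transform_triple (B_ w) (C_ w) (D_ w) /\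
    forall x, dom (N_ w) x -> C_ w x = B_ w (N_ w x) /\ x = B_ w x + D_ w (N_ w x).
  exact: svalP (projT2 (projT2 (bt w))).
clearbody D_ C_ B_; clear bt.
have triple w := (hbt w).1; have BN w := (hbt w).2.
pose e m x : forall w, K_ w := fun w => J_ w (op_pow (Snet w) m x).
have e_dom w m x : X x -> dom (N_ w) (e m x w) /\ N_ w (e m x w) = e m.+1 x w.
  (* Membership in the domain of the power [m.+1] says that the [m]-th iterate lies in the domain of
     [Snet w]. *)
  move=> /hX[_ /(_ w I)/(_ m.+1 I)] [_ dm].
  by have [_ _ /(_ _ dm)[d en]] := hext w; split=> //; exact: esym en.
have elim x y m n : X x -> X y ->
    ulimit U (fun w => inner (K_ w) (e m x w) (e n y w))
      (inner H (op_pow S m x) (op_pow S n y)).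
  move=> Xx Xy d d0; have /cvgrPdist_lt/(_ d d0) := hlim x y m n Xx Xy.
  by move=> /FU; apply: filterS => w; have [Jiso _ _] := hext w; rewrite /e Jiso.
(* Near the limit [l] the squared norm is at most [|l| + 1], hence at most its square. *)
have eP m x : X x -> fam_bounded U (e m x).
  move=> Xx; have := elim x x m m Xx Xx; set l := inner H _ _ => hl.
  exists (`|l| + 1); apply: filterS (hl 1 ltr01) => w.
  rewrite inner_norm distrC => h.
  have h' : `|e m x w| ^+ 2 <= `|l| + 1.
    have -> : `|e m x w| ^+ 2 = `| `|e m x w| ^+ 2 | by rewrite ger0_norm.
    rewrite -[X in `|X| <= _](subrK l) addrC; apply: le_trans (ler_normD _ _) _.
    by rewrite lerD2l ltW.
  rewrite -(@ler_pXn2r _ 2) ?nnegrE ?addr_ge0//; apply: le_trans h' _.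
  by rewrite expr2 ler_peMr ?addr_ge0// lerDr.
have ec m x : X x -> fam_core U B_ (e m x).
  move=> Xx; apply: (fam_core_of_step UU triple (eP m x Xx) (eP m.+1 x Xx)) => w.
  by have [d <-] := e_dom w m x Xx; exact: (BN w _ d).2.
have [K [J [N [Nnorm Jdot JNE]]]] := ultraproduct_normal UU triple.
have ke_dom m x : X x -> dom N (J (e m x)) /\ N (J (e m x)) = J (e m.+1 x).
  move=> Xx; apply: JNE => [||w]; [exact: ec|exact: ec|].
  by have [d <-] := e_dom w m x Xx; exact: (BN w _ d).1.
have ke_dot x y m n : X x -> X y -> inner K (J (e m x)) (J (e n y)) =
    inner H (op_pow S m x) (op_pow S n y).
  move=> Xx Xy; rewrite Jdot; [|exact: ec..].
  by apply: (fam_innerE UU); exact: elim.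
pose closedQ (Q : set (H * K)) :=
  Q 0 /\ forall a p q, Q p -> Q q -> Q (a *: p + q).
(* [G] is the linear span of the pairs [(S^m x, J (e m x))]. *)
pose G : set (H * K) := [set p | forall Q : set (H * K), closedQ Q ->
  (forall m x, X x -> Q (op_pow S m x, J (e m x))) -> Q p].
have Ggen m x : X x -> G (op_pow S m x, J (e m x)) by move=> Xx Q _; exact.
have Gcl : closedQ G.
  split=> [Q [] //|a p q Gp Gq Q cQ gQ]; have [_ lQ] := cQ.
  by apply: lQ; [exact: Gp|exact: Gq].
have Gind Q : closedQ Q -> (forall m x, X x -> Q (op_pow S m x, J (e m x))) -> G `<=` Q.
  by move=> cQ gQ p; exact.
(* Isometry on [G] is proved by induction on one argument at a time, starting from the generators
   given by [ke_dot]. *)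
have Giso0 p m x : X x -> G p ->
    inner H p.1 (op_pow S m x) = inner K p.2 (J (e m x)).
  move=> Xx; apply: (Gind [set p | inner H p.1 (op_pow S m x) = inner K p.2 (J (e m x))]).
    split=> [|a q r /= hq hr]; first by rewrite /= !inner0l.
    by rewrite /= !innerPl hq hr.
  by move=> n y Xy /=; rewrite ke_dot.
have Giso p q : G p -> G q -> inner H p.1 q.1 = inner K p.2 q.2.
  move=> Gp; apply: (Gind [set q | inner H p.1 q.1 = inner K p.2 q.2]).
    split=> [|a r t /= hr ht].
      by rewrite /= [LHS]innerC [RHS]innerC !inner0l.
    by rewrite /= !innerPr hr ht.
  by move=> n y Xy /=; exact: Giso0.
have FG a : lin (\bigcup_n (op_pow S n @` X)) a -> exists k, G (a, k).
  move=> [n [c [x [Xx ->]]]]; apply: (big_rec (fun v => exists k, G (v, k))).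
    by exists 0; exact: Gcl.1.
  move=> i v _ [k Gvk]; have [m _ [y Xy <-]] := Xx i.
  exists (c i *: J (e m y) + k).
  exact: (Gcl.2 (c i) (_, _) (_, _) (Ggen m y Xy) Gvk).
have [Fsub FdomS Fcore] := hcore.
have approx h n : dom S h -> exists a, [/\ lin (\bigcup_n (op_pow S n @` X)) a,
    `|h - a| <= 2 ^- n & `|S h - S a| <= 2 ^- n].
  move=> dh; have /Fcore/closure_prod_pow2P/(_ n) : graph S (h, S h) by exists h.
  by move=> [_ [_ [[a Fa [<- <-]] h1 h2]]]; exists a.
(* The span is dense because it approximates the domain of [S] in the graph norm, and that domain is
   dense. *)
have Gdense : closure [set h | exists k, G (h, k)] = setT.
  apply/seteqP; split=> // h _; apply/closure_pow2P => n.
  have /closure_pow2P/(_ n.+1)[y dy hy] : closure (dom S) h by rewrite hSdense.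
  have [a [Fa ya _]] := approx y n.+1 dy.
  exists a; first exact: FG.
  rewrite -(subrKA y) -(pow2_half n); apply: le_trans (ler_normD _ _) _.
  exact: lerD.
have [T [Tiso TG]] := isometric_extension Gcl.2 Giso Gdense.
have [[Nsub Nlin] Nclosed _ _] := Nnorm.
have GN p : G p -> [/\ dom S p.1, dom N p.2 & N p.2 = T (S p.1)].
  apply: (Gind [set p | [/\ dom S p.1, dom N p.2 & N p.2 = T (S p.1)]]).
    have [Ssub Slin] := hSlin.
    have S0 : S 0 = 0.
      by have := Slin (-1) 0 0 Ssub.1 Ssub.1; rewrite !scaleN1r !addNr.
    have N0 : N 0 = 0.
      by have := Nlin (-1) 0 0 Nsub.1 Nsub.1; rewrite !scaleN1r !addNr.
    split=> [|a r t [dr dr' er] [dt dt' et]].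
      by split; [exact: Ssub.1|exact: Nsub.1|rewrite N0 S0 linear0].
    split; [exact: Ssub.2|exact: Nsub.2|].
    by rewrite /= Nlin// Slin// linearP er et.
  move=> m x Xx /=; have [d ->] := ke_dom m x Xx; split => //.
    by have [/(_ m.+1 I) [_]] := hX x Xx.
  by rewrite -(TG _ _ (Ggen m.+1 x Xx)).
split => //; exists K, T, N; split => // h dh.
have Tnorm x : `|T x| = `|x|.
  by rewrite -!semi_norm_inner /semi_norm Tiso.
(* The core property approximates [(h, S h)] by pairs [(a, S a)] with [a] in the span; [T] maps
   these into the graph of [N], which is closed. *)
have : closure (graph N) (T h, T (S h)).
  apply/closure_prod_pow2P => n; have [a [Fa ha Sa]] := approx h n dh.
  have [k Gak] := FG a Fa; have [_ dk ek] := GN _ Gak.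
  exists k, (T (S a)); split; first by exists k => //; rewrite ek.
    by rewrite -(TG _ _ Gak) -linearB Tnorm.
  by rewrite -linearB Tnorm.
by move=> /Nclosed[x dx [<- <-]].
Qed.
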